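(* Let $r\ge 1$ be an integer, $0<\lambda\le1$, let $f:[0,1]\to\mathbb{R}$, $f\in C^r([0,1])$, with $V_\lambda(f^{(r)})<\infty$, and let $k\in\mathbb{N}$ have exactly $v$ non-zero base $b$ digits. Then for $v>r$ we have $$|\hat f(k)|\le b^{-\mu_r(k)-\lambda a_{r+1}}\,V_\lambda(f^{(r)})\,\frac{(b-1)^{1+\lambda}(1+2b^{-\lambda})}{(2\sin\frac\pi b)^r}\left(1+\frac1b+\frac1{b(b+1)}\right)^{r-1};$$ for $v=r$ we have $$|\hat f(k)|\le\frac{b^{-\mu_r(k)}}{(2\sin\frac\pi b)^r}\left(1+\frac1b+\frac1{b(b+1)}\right)^{r-1}\left(\left|\int_0^1f^{(r)}(x)\,dx\right|+2(b-1)^{1+\lambda}b^{-\lambda a_r}V_\lambda(f^{(r)})\right);$$ and for $v<r$ we have $$|\hat f(k)|\le\frac{b^{-\mu_r(k)}}{(2\sin\frac\pi b)^v}\left(1+\frac1b+\frac1{b(b+1)}\right)^{v-1}\left[3\sum_{s=v}^{r-1}\frac{|f^{(s)}(0)|}{(s-v+1)!}+\left(\left|\int_0^1f^{(v)}(x)\,dx\right|+2(b-1)^{1+\lambda}b^{-\lambda a_v}V_\lambda(f^{(v)})\right)\right].$$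
   Context: Let $b\ge 2$ be an integer and $\omega_b=e^{2\pi \mathrm{i}/b}$; $\mathbb{N}=\{1,2,\ldots\}$. Each $k\in\mathbb{N}$ has the base $b$ expansion $k=\kappa_1b^{a_1-1}+\cdots+\kappa_vb^{a_v-1}$ with $v\ge1$, $0<\kappa_1,\ldots,\kappa_v<b$ and $a_1>\cdots>a_v>0$ integers; for $k=0$ set $v=0$. For $x\in[0,1)$ with base $b$ representation $x=\frac{x_1}{b}+\frac{x_2}{b^2}+\cdots$, $0\le x_i<b$, infinitely many $x_i\neq b-1$, the $k$th Walsh function is $\mathrm{wal}_k(x)=\omega_b^{\kappa_1x_{a_1}+\cdots+\kappa_vx_{a_v}}$, and $\mathrm{wal}_0(x)=1$. The $k$th Walsh coefficient of $f:[0,1]\to\mathbb{R}$ is $\hat f(k)=\int_0^1f(x)\overline{\mathrm{wal}_k(x)}\,dx$. For integers $r\ge0$, $k\ge 0$ define $\mu_r(k)=0$ if $r=0$ or $k=0$; $\mu_r(k)=a_1+\cdots+a_v$ if $1\le v\le r$; and $\mu_r(k)=a_1+\cdots+a_r$ if $v>r\ge1$. For $0<\lambda\le1$ and $g:[0,1]\to\mathbb{R}$ the variation of fractional order $\lambda$ is $$V_\lambda(g)=\sup_{0=x_0<x_1<\cdots<x_{N-1}<x_N=1}\ \sum_{n=1}^N|x_n-x_{n-1}|\,\frac{|g(x_n)-g(x_{n-1})|}{|x_n-x_{n-1}|^\lambda},$$ the supremum being over all partitions of $[0,1]$. $f^{(s)}$ denotes the $s$th derivative of $f$. *)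

(* Defs.v *)
From Stdlib Require Import Reals Lra Lia List Arith ZArith.
From Coquelicot Require Import Coquelicot.

Open Scope R_scope.

(* The coefficient of [b ^ (a - 1)] in the base [b] expansion of [k], [a >= 1]. *)
Definition digit (b k a : nat) : nat := ((k / b ^ (a - 1)) mod b)%nat.

(* The list a_1 > ... > a_v > 0 of positions of the non-zero digits of [k].
   Positions larger than [k] are irrelevant, as k < b ^ k for b >= 2;
   see [digits_expansion]. *)
Definition positions (b k : nat) : list nat :=
  filter (fun a => negb (digit b k a =? 0)%nat) (rev (seq 1 k)).

Definition num_digits (b k : nat) : nat := length (positions b k).

(* The position a_i of the [i]-th non-zero digit from the left, 1 <= i <= v. *)
Definition digit_pos (b k i : nat) : nat := nth (i - 1) (positions b k) 0%nat.

(* [firstn] returns the whole list when v <= r. *)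
Definition mu (b r k : nat) : nat := list_sum (firstn r (positions b k)).

(* The digit x_i, i >= 1, of x in [0,1). Since x_i is read off the integer part
   of b^i x, a terminating representation is preferred to one ending in
   digits b - 1; see [xdigit_series] and [xdigit_infinitely_often]. *)
Definition xdigit (b : nat) (x : R) (i : nat) : nat :=
  (Z.to_nat (Int_part (INR b ^ i * x)) mod b)%nat.

Lemma digits_expansion (b k : nat) : (2 <= b)%nat ->
  k = list_sum (map (fun a => digit b k a * b ^ (a - 1))%nat (positions b k)).
Proof.
intros hb.
assert (H : forall n, (k mod b ^ n)%nat =
  list_sum (map (fun a => digit b k a * b ^ (a - 1))%nat
    (filter (fun a => negb (digit b k a =? 0)%nat) (rev (seq 1 n))))).
{ induction n as [|n IH].
  - rewrite Nat.pow_0_r, Nat.mod_1_r. reflexivity.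
  - rewrite seq_S, rev_app_distr.
    change (rev (1 + n :: nil)%nat) with (S n :: nil); cbn [app filter].
    replace (k mod b ^ S n)%nat
      with (digit b k (S n) * b ^ (S n - 1) + k mod b ^ n)%nat.
    2: { unfold digit. replace (S n - 1)%nat with n by lia.
         rewrite Nat.pow_succ_r', (Nat.mul_comm b (b ^ n)),
           Nat.Div0.mod_mul_r. lia. }
    rewrite IH.
    destruct (Nat.eqb_spec (digit b k (S n)) 0) as [e|e]; cbn [negb].
    + rewrite e. reflexivity.
    + reflexivity. }
unfold positions. rewrite <- H, Nat.mod_small; [reflexivity|].
apply Nat.pow_gt_lin_r. lia.
Qed.

Lemma floor_bounds (y : R) : 0 <= y ->
  INR (Z.to_nat (Int_part y)) <= y < INR (Z.to_nat (Int_part y)) + 1.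
Proof.
intros hy. destruct (base_Int_part y) as [h1 h2].
assert (h3 : (0 <= Int_part y)%Z).
{ assert (IZR (-1) < IZR (Int_part y)) as h by (simpl; lra).
  apply lt_IZR in h. lia. }
rewrite INR_IZR_INZ, Z2Nat.id by assumption. lra.
Qed.

Lemma floor_step (b n : nat) (x : R) : (2 <= b)%nat -> 0 <= x ->
  Z.to_nat (Int_part (INR b ^ S n * x)) =
  (b * Z.to_nat (Int_part (INR b ^ n * x)) + xdigit b x (S n))%nat.
Proof.
intros hb hx. unfold xdigit.
assert (hb0 : 2 <= INR b) by (apply (le_INR 2), hb).
assert (hp : forall m, 0 <= INR b ^ m * x).
{ intros m. apply Rmult_le_pos; [apply pow_le; lra | exact hx]. }
destruct (floor_bounds _ (hp n)) as [u1 u2].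
destruct (floor_bounds _ (hp (S n))) as [w1 w2].
rewrite <- tech_pow_Rmult, Rmult_assoc in *.
set (y := INR b ^ n * x) in *.
set (u := Z.to_nat (Int_part y)) in *.
set (w := Z.to_nat (Int_part (INR b * y))) in *.
assert (l1 : (b * u < w + 1)%nat).
{ apply INR_lt. rewrite mult_INR, plus_INR. simpl. nra. }
assert (l2 : (w < b * (u + 1))%nat).
{ apply INR_lt. rewrite mult_INR, plus_INR. simpl. nra. }
rewrite (Nat.div_mod_eq w b) at 1. f_equal. f_equal.
symmetry. apply (Nat.div_unique w b u (w - b * u)); lia.
Qed.

Lemma xdigit_partial_sum (b n : nat) (x : R) : (2 <= b)%nat -> 0 <= x < 1 ->
  sum_n (fun i => INR (xdigit b x (S i)) / INR b ^ S i) n =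
  INR (Z.to_nat (Int_part (INR b ^ S n * x))) / INR b ^ S n.
Proof.
intros hb hx.
assert (hb0 : INR b <> 0) by (apply not_0_INR; lia).
induction n as [|n IH].
- rewrite sum_O, (floor_step b 0 x) by lra || lia.
  replace (Z.to_nat (Int_part (INR b ^ 0 * x))) with 0%nat.
  + rewrite Nat.mul_0_r. reflexivity.
  + rewrite pow_O, Rmult_1_l. destruct (floor_bounds x) as [h1 h2]; [lra|].
    destruct (Z.to_nat (Int_part x)) as [|m]; [reflexivity|].
    rewrite S_INR in h1. pose proof (pos_INR m). lra.
- rewrite sum_Sn, IH, (floor_step b (S n) x) by lra || lia.
  rewrite plus_INR, mult_INR. unfold plus; simpl. field.
  split; [apply pow_nonzero|]; exact hb0.
Qed.

Lemma xdigit_series (b : nat) (x : R) : (2 <= b)%nat -> 0 <= x < 1 ->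
  is_series (fun i => INR (xdigit b x (S i)) / INR b ^ S i) x.
Proof.
intros hb hx.
assert (hb0 : 2 <= INR b) by (apply (le_INR 2), hb).
change (is_lim_seq
  (sum_n (fun i => INR (xdigit b x (S i)) / INR b ^ S i)) x).
apply is_lim_seq_le_le with
  (u := fun n => x - (/ INR b) ^ S n) (w := fun _ => x).
- intros n. rewrite (xdigit_partial_sum b n x hb hx), pow_inv.
  assert (hp : 0 < INR b ^ S n) by (apply pow_lt; lra).
  destruct (floor_bounds (INR b ^ S n * x)) as [h1 h2].
  { apply Rmult_le_pos; lra. }
  set (p := INR b ^ S n) in *.
  set (u := INR (Z.to_nat (Int_part (p * x)))) in *.
  split; apply Rmult_le_reg_l with p; try assumption; field_simplify; lra.
- replace (Finite x) with (Finite (x - 0)) by (f_equal; ring).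
  apply (is_lim_seq_minus' (fun _ => x)); [apply is_lim_seq_const|].
  apply (is_lim_seq_incr_1 (fun n => (/ INR b) ^ n)).
  apply is_lim_seq_geom.
  rewrite Rabs_pos_eq by (left; apply Rinv_0_lt_compat; lra).
  rewrite <- Rinv_1. apply Rinv_lt_contravar; lra.
- apply is_lim_seq_const.
Qed.

Lemma xdigit_infinitely_often (b : nat) (x : R) :
  (2 <= b)%nat -> 0 <= x < 1 ->
  forall n, exists m, (n <= m)%nat /\ xdigit b x (S m) <> (b - 1)%nat.
Proof.
intros hb hx n.
destruct (Classical_Prop.classic
  (exists m, (n <= m)%nat /\ xdigit b x (S m) <> (b - 1)%nat)) as [h|h];
  [exact h | exfalso].
assert (hb0 : 2 <= INR b) by (apply (le_INR 2), hb).
assert (hd : forall m, (n <= m)%nat -> xdigit b x (S m) = (b - 1)%nat).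
{ intros m hm. destruct (Nat.eq_dec (xdigit b x (S m)) (b - 1)) as [e|e];
    [exact e | exfalso; apply h; exists m; split; assumption]. }
set (u := fun m => Z.to_nat (Int_part (INR b ^ m * x))).
assert (hu : forall m, (u (n + m) + 1 = b ^ m * (u n + 1))%nat).
{ induction m as [|m IH].
  - rewrite Nat.add_0_r. simpl. lia.
  - assert (hs : u (n + S m)%nat = (b * u (n + m) + (b - 1))%nat).
    { rewrite Nat.add_succ_r, <- (hd (n + m)%nat) by lia.
      apply floor_step; lra || lia. }
    rewrite hs, Nat.pow_succ_r'. nia. }
destruct (floor_bounds (INR b ^ n * x)) as [_ h2].
{ apply Rmult_le_pos; [apply pow_le|]; lra. }
fold (u n) in h2.
set (e := INR (u n) + 1 - INR b ^ n * x) in *.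
assert (he : 0 < e) by (unfold e; lra).
destruct (Pow_x_infinity (INR b)) with (b := 2 / e) as [M hM].
{ rewrite Rabs_pos_eq; lra. }
specialize (hM M (Nat.le_refl M)).
rewrite Rabs_pos_eq in hM by (apply pow_le; lra).
destruct (floor_bounds (INR b ^ (n + M) * x)) as [h1 _].
{ apply Rmult_le_pos; [apply pow_le|]; lra. }
fold (u (n + M)%nat) in h1.
pose proof (f_equal INR (hu M)) as hi.
rewrite plus_INR, mult_INR, plus_INR, pow_INR in hi. simpl in hi.
rewrite pow_add in h1.
assert (hc : INR b ^ M * e <= 1) by (unfold e; nra).
assert (hg : 2 / e * e = 2) by (field; lra).
assert (2 / e * e <= INR b ^ M * e) by (apply Rmult_le_compat_r; lra).
lra.
Qed.

Definition omega (b : nat) : C := (cos (2 * PI / INR b), sin (2 * PI / INR b)).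

(* Meaningful for x in [0,1) only; the value at x = 1 does not affect
   integrals over [0,1]. For k = 0 the exponent is an empty sum. *)
Definition wal (b k : nat) (x : R) : C :=
  Cpow (omega b)
    (list_sum (map (fun a => digit b k a * xdigit b x a)%nat (positions b k))).

Definition walsh_coef (b : nat) (f : R -> R) (k : nat) : C :=
  RInt (V := C_R_CompleteNormedModule)
    (fun x => Cmult (RtoC (f x)) (Cconj (wal b k x))) 0 1.

(* A function on [0,1] is represented by some f : R -> R of which only the
   values on [0,1] are used; in particular derivatives at 0 and 1 are
   one-sided. *)

Definition I01 (x : R) : Prop := 0 <= x <= 1.

Definition is_deriv01 (f : R -> R) (x l : R) : Prop :=
  filterlim (fun y => (f y - f x) / (y - x))
    (within (fun y => I01 y /\ y <> x) (locally x)) (locally l).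

Definition deriv01 (f : R -> R) (x : R) : R := iota (is_deriv01 f x).

Fixpoint deriv01_n (f : R -> R) (s : nat) : R -> R :=
  match s with
  | O => f
  | S s => deriv01 (deriv01_n f s)
  end.

Definition C01 (r : nat) (f : R -> R) : Prop :=
  (forall s x, (s < r)%nat -> I01 x -> exists l, is_deriv01 (deriv01_n f s) x l)
  /\ continuous_on I01 (deriv01_n f r).

Definition is_partition01 (N : nat) (x : nat -> R) : Prop :=
  x 0%nat = 0 /\ x N = 1 /\ forall n, (n < N)%nat -> x n < x (S n).

Definition variation_sum (lambda : R) (g : R -> R) (N : nat) (x : nat -> R) : R :=
  sum_n_m (fun n => Rabs (x n - x (n - 1)%nat) *
    (Rabs (g (x n) - g (x (n - 1)%nat)) /
     Rpower (Rabs (x n - x (n - 1)%nat)) lambda)) 1 N.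

Definition variation (lambda : R) (g : R -> R) : Rbar :=
  Lub_Rbar (fun t => exists (N : nat) (x : nat -> R),
    is_partition01 N x /\ t = variation_sum lambda g N x).

(* Main.v *)
(* Let z = exp(-2 pi i / b) and let a be the leading position of k, h = b^-a.
   Integration by parts turns the k-th coefficient of f into minus the integral
   of f' against the primitive J of the conjugate Walsh function.  On each grid
   interval of length h the function J / h is a combination of the Walsh
   functions of k and of k minus its leading digit, plus the Walsh function of k
   times the fractional part of x / h; expanding the digits of the latter by a
   finite Fourier transform gives Walsh functions of k with a further leading
   digit.  So a coefficient of f is bounded by a geometrically weighted sum of
   coefficients of f', which drives an induction on the number of derivatives.
   For the last derivative, Abel summation over the grid points t + m h reduces
   the coefficient to increments of step h, controlled by the variation.

   In the case v = r the factor 1 + 2 b^-lambda of the case v > r may exceed 2,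
   so the induction needs slightly more than the stated bounds: the initial
   estimate is proved with floor(b / 2) instead of (b - 1)^(1 + lambda), and the
   coefficient of the k-th Walsh function in J vanishes for b = 2. *)

Require Import Defs.
From Stdlib Require Import Reals Arith Lra Lia List ZArith.
From Coquelicot Require Import Coquelicot.

Open Scope R_scope.

(** * Complex integrals and finite sums *)


Definition is_RIntC (f : R -> C) (a b : R) (l : C) : Prop :=
  is_RInt (V := C_R_NormedModule) f a b l.

Lemma is_RIntC_pair (f : R -> C) (a b : R) (l : C) :
  is_RInt (fun x => fst (f x)) a b (fst l) ->
  is_RInt (fun x => snd (f x)) a b (snd l) -> is_RIntC f a b l.
Proof.
intros h1 h2. destruct l as [l1 l2].
exact (is_RInt_fct_extend_pair f a b l1 l2 h1 h2).
Qed.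

Lemma is_RIntC_fst (f : R -> C) (a b : R) (l : C) :
  is_RIntC f a b l -> is_RInt (fun x => fst (f x)) a b (fst l).
Proof.
intros h. destruct l as [l1 l2].
exact (is_RInt_fct_extend_fst (U := R_NormedModule) (V := R_NormedModule)
  f a b (l1, l2) h).
Qed.

Lemma is_RIntC_snd (f : R -> C) (a b : R) (l : C) :
  is_RIntC f a b l -> is_RInt (fun x => snd (f x)) a b (snd l).
Proof.
intros h. destruct l as [l1 l2].
exact (is_RInt_fct_extend_snd (U := R_NormedModule) (V := R_NormedModule)
  f a b (l1, l2) h).
Qed.

Lemma is_RIntC_ext (f g : R -> C) (a b : R) (l : C) : a <= b ->
  (forall x, a < x < b -> f x = g x) -> is_RIntC f a b l -> is_RIntC g a b l.
Proof.
intros hab h. apply is_RInt_ext. intros x hx.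
rewrite Rmin_left, Rmax_right in hx by assumption. apply h, hx.
Qed.

Lemma is_RIntC_eq (f : R -> C) (a b : R) (l l' : C) :
  is_RIntC f a b l -> l = l' -> is_RIntC f a b l'.
Proof. intros h <-. exact h. Qed.

Lemma is_RIntC_plus (f g : R -> C) (a b : R) (l m : C) :
  is_RIntC f a b l -> is_RIntC g a b m ->
  is_RIntC (fun x => (f x + g x)%C) a b (l + m)%C.
Proof. intros h1 h2. exact (is_RInt_plus _ _ _ _ _ _ h1 h2). Qed.

Lemma is_RIntC_scal (c : C) (f : R -> C) (a b : R) (l : C) :
  is_RIntC f a b l -> is_RIntC (fun x => (c * f x)%C) a b (c * l)%C.
Proof.
intros h. pose proof (is_RIntC_fst _ _ _ _ h) as h1.
pose proof (is_RIntC_snd _ _ _ _ h) as h2.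
apply is_RIntC_pair.
- exact (is_RInt_minus _ _ _ _ _ _ (is_RInt_scal _ _ _ (fst c) _ h1)
    (is_RInt_scal _ _ _ (snd c) _ h2)).
- exact (is_RInt_plus _ _ _ _ _ _ (is_RInt_scal _ _ _ (fst c) _ h2)
    (is_RInt_scal _ _ _ (snd c) _ h1)).
Qed.

Lemma is_RIntC_zero (a b : R) : is_RIntC (fun _ => RtoC 0) a b (RtoC 0).
Proof.
eapply is_RIntC_eq; [apply (is_RInt_const (V := C_R_NormedModule))|].
exact (@scal_zero_r R_AbsRing C_R_NormedModule (b - a)).
Qed.

Lemma is_RIntC_unique (f : R -> C) (a b : R) (l m : C) :
  is_RIntC f a b l -> is_RIntC f a b m -> l = m.
Proof.
intros h1 h2.
rewrite <- (is_RInt_unique (V := C_R_CompleteNormedModule) f a b l h1).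
exact (is_RInt_unique (V := C_R_CompleteNormedModule) f a b m h2).
Qed.

Lemma is_RIntC_Chasles (f : R -> C) (a b c : R) (l m : C) :
  is_RIntC f a b l -> is_RIntC f b c m -> is_RIntC f a c (l + m)%C.
Proof. intros h1 h2. exact (is_RInt_Chasles f a b c l m h1 h2). Qed.

Lemma is_RIntC_bound (f : R -> C) (a b : R) (l : C) (M : R) : a <= b ->
  (forall x, a < x < b -> Cmod (f x) <= M) -> 0 <= M -> is_RIntC f a b l ->
  Cmod l <= (b - a) * M.
Proof.
intros hab h hM hi. rewrite Cmod_norm.
(* Setting [f] to zero outside the open interval extends the estimate to the end points without
   changing the integral. *)
set (f' := fun x => if Rlt_dec a x then if Rlt_dec x b then f x else RtoC 0
   else RtoC 0).
apply (norm_RInt_le_const (V := C_R_NormedModule) f' a b l M hab).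
- intros x _. rewrite <- Cmod_norm. unfold f'.
  destruct (Rlt_dec a x); [destruct (Rlt_dec x b)|];
    try (rewrite Cmod_0; assumption). apply h. lra.
- apply (is_RIntC_ext f); [assumption| |exact hi].
  intros x hx. unfold f'. destruct (Rlt_dec a x); [|lra].
  destruct (Rlt_dec x b); [reflexivity | lra].
Qed.

Lemma is_RIntC_real (f : R -> R) (a b l : R) :
  is_RInt f a b l -> is_RIntC (fun x => RtoC (f x)) a b (RtoC l).
Proof.
intros h. apply is_RIntC_pair; [exact h|]. simpl.
pose proof (is_RInt_const a b 0) as h0.
unfold scal in h0; simpl in h0; unfold mult in h0; simpl in h0.
rewrite Rmult_0_r in h0. exact h0.
Qed.

Lemma RtoC_m1 : RtoC (-1) = (- RtoC 1)%C.
Proof. unfold RtoC, Copp; simpl. f_equal; ring. Qed.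

Fixpoint csum (f : nat -> C) (n : nat) : C :=
  match n with O => RtoC 0 | S n => (csum f n + f n)%C end.

Lemma is_RIntC_csum (f : nat -> R -> C) (a b : R) (l : nat -> C) (n : nat) :
  (forall i, (i < n)%nat -> is_RIntC (f i) a b (l i)) ->
  is_RIntC (fun x => csum (fun i => f i x) n) a b (csum l n).
Proof.
induction n as [|n IH]; intros h; cbn [csum].
- apply is_RIntC_zero.
- apply is_RIntC_plus; [apply IH; intros|]; apply h; lia.
Qed.

Lemma csum_ext (f g : nat -> C) (n : nat) :
  (forall i, (i < n)%nat -> f i = g i) -> csum f n = csum g n.
Proof.
induction n as [|n IH]; intros h; cbn [csum]; [reflexivity|].
rewrite IH, h by auto with arith. reflexivity.
Qed.

Lemma csum_scal (c : C) (f : nat -> C) (n : nat) :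
  csum (fun i => (c * f i)%C) n = (c * csum f n)%C.
Proof. induction n as [|n IH]; cbn [csum]; [|rewrite IH]; ring. Qed.

Lemma csum_plus (f g : nat -> C) (n : nat) :
  csum (fun i => (f i + g i)%C) n = (csum f n + csum g n)%C.
Proof. induction n as [|n IH]; cbn [csum]; [|rewrite IH]; ring. Qed.

Lemma csum_const (c : C) (n : nat) : csum (fun _ => c) n = (RtoC (INR n) * c)%C.
Proof.
induction n as [|n IH]; cbn [csum]; [simpl; ring|].
rewrite IH, S_INR, RtoC_plus. ring.
Qed.

Lemma csum_split (f : nat -> C) (m n : nat) :
  csum f (m + n) = (csum f m + csum (fun i => f (m + i)%nat) n)%C.
Proof.
induction n as [|n IH].
- rewrite Nat.add_0_r. cbn [csum]. ring.
- rewrite Nat.add_succ_r. cbn [csum]. rewrite IH. ring.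
Qed.

Lemma csum_first (f : nat -> C) (n : nat) :
  csum f (S n) = (f O + csum (fun i => f (S i)) n)%C.
Proof.
induction n as [|n IH]; [cbn [csum]; ring|].
change (csum f (S (S n))) with (csum f (S n) + f (S n))%C.
rewrite IH. cbn [csum]. ring.
Qed.

Lemma csum_rev (f : nat -> C) (n : nat) :
  csum f n = csum (fun i => f (n - 1 - i)%nat) n.
Proof.
induction n as [|n IH]; [reflexivity|].
rewrite (csum_first (fun i => f (S n - 1 - i)%nat)). cbn [csum].
rewrite IH, Cplus_comm. f_equal; [f_equal; lia|].
apply csum_ext. intros i hi. f_equal. lia.
Qed.

Lemma csum_bound (f : nat -> C) (n : nat) (M : R) :
  (forall i, (i < n)%nat -> Cmod (f i) <= M) -> Cmod (csum f n) <= INR n * M.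
Proof.
induction n as [|n IH]; intros h.
- cbn [csum]. rewrite Cmod_0. simpl. lra.
- cbn [csum]. rewrite S_INR.
  eapply Rle_trans; [apply Cmod_triangle|].
  assert (Cmod (csum f n) <= INR n * M) by (apply IH; auto with arith).
  assert (Cmod (f n) <= M) by (apply h; lia). lra.
Qed.

Lemma csum_geometric_bound (f : nat -> C) (n : nat) (A x : R) :
  0 <= A -> 0 <= x < 1 ->
  (forall i, (i < n)%nat -> Cmod (f i) <= A * x ^ S i) ->
  Cmod (csum f n) <= A * (x / (1 - x)).
Proof.
intros hA hx h.
(* The induction runs on the exact partial geometric sum; the full sum [x / (1 - x)] would not be
   inductive. *)
assert (H : Cmod (csum f n) <= A * (x * (1 - x ^ n) / (1 - x))).
{ induction n as [|n IH]; cbn [csum].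
  - rewrite Cmod_0. simpl. right. field. lra.
  - eapply Rle_trans; [apply Cmod_triangle|].
    assert (h1 := IH (fun i hi => h i (Nat.lt_lt_succ_r _ _ hi))).
    assert (h2 := h n (Nat.lt_succ_diag_r n)).
    replace (A * (x * (1 - x ^ S n) / (1 - x))) with
      (A * (x * (1 - x ^ n) / (1 - x)) + A * x ^ S n)
      by (simpl; field; lra). lra. }
eapply Rle_trans; [exact H|]. apply Rmult_le_compat_l; [exact hA|].
apply Rmult_le_compat_r; [left; apply Rinv_0_lt_compat; lra|].
pose proof (pow_le x n (proj1 hx)). nra.
Qed.

Lemma csum_power_step (z : C) (n : nat) :
  ((1 - z) * csum (fun i => z ^ i) n = 1 - z ^ n)%C.
Proof.
induction n as [|n IH]; cbn [csum]; [simpl; ring|].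
rewrite Cmult_plus_distr_l, IH, Cpow_S. ring.
Qed.

(** * Roots of unity *)


(** The conjugate root of unity, because Walsh coefficients integrate against conjugate Walsh
    functions. *)
Definition zeta (b : nat) : C := Cconj (omega b).

(** The angle is written as a double so that the double-angle formulas apply to [1 - zeta b ^ n]. *)
Lemma zeta_pow (b n : nat) : (2 <= b)%nat ->
  (zeta b ^ n)%C = (cos (2 * (PI * INR n / INR b)), - sin (2 * (PI * INR n / INR b))).
Proof.
intros hb. assert (hb0 : 0 < INR b) by (apply lt_0_INR; lia).
induction n as [|n IH].
- simpl. replace (2 * (PI * 0 / INR b)) with 0 by (field; lra).
  rewrite cos_0, sin_0, Ropp_0. reflexivity.
- rewrite Cpow_S, IH, S_INR. unfold zeta, omega, Cconj, Cmult; simpl.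
  replace (2 * (PI * (INR n + 1) / INR b))
    with (2 * PI / INR b + 2 * (PI * INR n / INR b)) by (field; lra).
  rewrite cos_plus, sin_plus. f_equal; ring.
Qed.

Lemma Cmod_zeta (b : nat) : Cmod (zeta b) = 1.
Proof.
unfold zeta. rewrite Cmod_conj. unfold Cmod, omega; simpl.
pose proof (sin2_cos2 (2 * PI / INR b)) as h. unfold Rsqr in h.
transitivity (sqrt 1); [f_equal; nra | apply sqrt_1].
Qed.

Lemma Cmod_zeta_pow (b n : nat) : Cmod (zeta b ^ n) = 1.
Proof. rewrite Cmod_pow, Cmod_zeta. apply pow1. Qed.

Lemma zeta_pow_b (b : nat) : (2 <= b)%nat -> (zeta b ^ b)%C = RtoC 1.
Proof.
intros hb. assert (hb0 : 0 < INR b) by (apply lt_0_INR; lia).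
rewrite zeta_pow by assumption.
replace (2 * (PI * INR b / INR b)) with (2 * PI) by (field; lra).
rewrite cos_2PI, sin_2PI, Ropp_0. reflexivity.
Qed.

Lemma zeta_two : zeta 2 = (- (1))%C.
Proof.
unfold zeta, omega, Cconj, Copp; simpl.
replace (2 * PI / (1 + 1)) with PI by field.
rewrite cos_PI, sin_PI. reflexivity.
Qed.

Lemma sin_PI_div_pos (b : nat) : (2 <= b)%nat -> 0 < sin (PI / INR b).
Proof.
intros hb. assert (hb0 : 2 <= INR b) by (apply (le_INR 2), hb).
pose proof PI_RGT_0. apply sin_gt_0.
- apply Rdiv_lt_0_compat; lra.
- apply Rmult_lt_reg_r with (INR b); [lra|]. field_simplify; nra.
Qed.

Lemma sin_PI_div_min (b j : nat) : (0 < j < b)%nat ->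
  sin (PI / INR b) <= sin (PI * INR j / INR b).
Proof.
intros hj. pose proof PI_RGT_0 as hpi.
assert (hb : 2 <= INR b) by (apply (le_INR 2); lia).
assert (h1 : 1 <= INR j) by (apply (le_INR 1); lia).
assert (h2 : INR j + 1 <= INR b)
  by (rewrite <- S_INR; apply le_INR; lia).
assert (e : PI * INR j / INR b = INR j * (PI / INR b)) by (field; lra).
assert (hx : 0 < PI / INR b) by (apply Rdiv_lt_0_compat; lra).
assert (hxb : INR b * (PI / INR b) = PI) by (field; lra).
rewrite e. set (x := PI / INR b) in *.
(* Beyond [PI / 2] the reflection [PI - j x = (b - j) x] brings the angle back to the increasing
   range, where it is still at least [x]. *)
destruct (Rle_dec (INR j * x) (PI / 2)) as [h|h].
- apply sin_incr_1; nra.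
- rewrite <- (sin_PI_x (INR j * x)). apply sin_incr_1; nra.
Qed.

(** With [t = PI j / b], the chord from 1 to [exp(-2 i t)] has length [2 sin t], and [sin t] is
    smallest for [j = 1] or [j = b - 1]. This is the origin of the denominators [2 sin(PI / b)]. *)
Lemma Cmod_one_minus_zeta_pow (b j : nat) : (0 < j < b)%nat ->
  2 * sin (PI / INR b) <= Cmod (1 - zeta b ^ j).
Proof.
intros hj. pose proof (sin_PI_div_min b j hj) as h.
pose proof (sin_PI_div_pos b ltac:(lia)) as hp.
rewrite zeta_pow by lia.
set (t := PI * INR j / INR b) in *.
replace (Cmod (1 - (cos (2 * t), - sin (2 * t)))) with (2 * sin t); [lra|].
unfold Cmod, Cminus, Cplus, Copp; simpl.
rewrite cos_2a_sin, sin_2a.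
pose proof (sin2_cos2 t) as e. unfold Rsqr in e.
transitivity (sqrt (Rsqr (2 * sin t))); [symmetry; apply sqrt_Rsqr; lra|].
f_equal. unfold Rsqr.
transitivity (4 * (sin t * sin t) * (sin t * sin t + cos t * cos t));
  [rewrite e; ring | ring].
Qed.

Lemma one_minus_zeta_pow_neq_0 (b j : nat) : (0 < j < b)%nat ->
  (1 - zeta b ^ j)%C <> RtoC 0.
Proof.
intros hj e. pose proof (Cmod_one_minus_zeta_pow b j hj) as h.
pose proof (sin_PI_div_pos b ltac:(lia)).
rewrite e, Cmod_0 in h. lra.
Qed.

Lemma Cmod_div_one_minus_zeta_pow (b j : nat) (c : C) : (0 < j < b)%nat ->
  Cmod (c / (1 - zeta b ^ j)) <= Cmod c * / (2 * sin (PI / INR b)).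
Proof.
intros hj. pose proof (Cmod_one_minus_zeta_pow b j hj) as h.
pose proof (sin_PI_div_pos b ltac:(lia)).
rewrite Cmod_div by (apply one_minus_zeta_pow_neq_0; assumption).
apply Rmult_le_compat_l; [apply Cmod_ge_0|].
apply Rinv_le_contravar; lra.
Qed.

Lemma zeta_geometric_sum (b j : nat) : (0 < j < b)%nat ->
  csum (fun i => (zeta b ^ j) ^ i)%C b = RtoC 0.
Proof.
intros hj. pose proof (one_minus_zeta_pow_neq_0 b j hj) as hn.
pose proof (csum_power_step (zeta b ^ j) b) as h.
rewrite <- Cpow_mult_r, Nat.mul_comm, Cpow_mult_r, zeta_pow_b, Cpow_1_l in h by lia.
replace (csum (fun i => (zeta b ^ j) ^ i)%C b) with
 ((1 - zeta b ^ j) * csum (fun i => (zeta b ^ j) ^ i) b / (1 - zeta b ^ j))%C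
 by (field; exact hn).
rewrite h. field. exact hn.
Qed.

(* A partial sum of the vanishing full sum is also minus its complement, hence
   bounded by the smaller of the two numbers of terms. *)
Lemma zeta_partial_geometric_sum (b k j : nat) : (0 < k < b)%nat -> (j <= b)%nat ->
  Cmod (csum (fun i => (zeta b ^ k) ^ i)%C j) <= INR (b / 2).
Proof.
intros hk hj.
assert (hm : forall i, Cmod ((zeta b ^ k) ^ i)%C <= 1).
{ intros i. rewrite Cmod_pow, Cmod_zeta_pow, pow1. lra. }
destruct (Nat.le_gt_cases j (b / 2)) as [h|h].
- apply Rle_trans with (INR j * 1); [apply csum_bound; auto|].
  rewrite Rmult_1_r. apply le_INR, h.
- assert (e : csum (fun i => (zeta b ^ k) ^ i)%C (j + (b - j)) = RtoC 0)
    by (replace (j + (b - j))%nat with b by lia;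
        apply zeta_geometric_sum, hk).
  rewrite csum_split in e.
  set (u := csum (fun i => (zeta b ^ k) ^ i)%C j) in *.
  set (w := csum (fun i => (zeta b ^ k) ^ (j + i))%C (b - j)) in *.
  replace u with (- w)%C
    by (replace (- w)%C with (u - (u + w))%C by ring; rewrite e; ring).
  rewrite Cmod_opp.
  apply Rle_trans with (INR (b - j) * 1); [apply csum_bound; auto|].
  rewrite Rmult_1_r. apply le_INR.
  pose proof (Nat.div_mod_eq b 2). pose proof (Nat.mod_upper_bound b 2). lia.
Qed.

(** The Fourier coefficient of the identity on the residues [0, ..., b - 1] at the character
    [j -> zeta b ^ (S t * j)]. The shift by one makes [t < b - 1] enumerate the nontrivial
    characters. *)
Definition digit_coef (b t : nat) : C :=
  (zeta b ^ S t / (1 - zeta b ^ S t))%C.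

Lemma digit_coef_bound (b t : nat) : (t < b - 1)%nat ->
  Cmod (digit_coef b t) <= / (2 * sin (PI / INR b)).
Proof.
intros ht. unfold digit_coef.
eapply Rle_trans; [apply Cmod_div_one_minus_zeta_pow; lia|].
rewrite Cmod_zeta_pow. lra.
Qed.

(** The exponents [S t] and [b - S t] are paired: if [u w = 1] then
    [u / (1 - u) + w / (1 - w) = -1]. This is the value of the digit expansion at [j = 0]. *)
Lemma digit_coef_sum (b : nat) : (2 <= b)%nat ->
  csum (digit_coef b) (b - 1) = RtoC (- ((INR b - 1) / 2)).
Proof.
intros hb.
assert (h : (csum (digit_coef b) (b - 1) + csum (digit_coef b) (b - 1))%C
  = RtoC (- (INR b - 1))).
{ rewrite (csum_rev (digit_coef b)) at 2. rewrite <- csum_plus.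
  rewrite (csum_ext _ (fun _ => RtoC (-1))).
  - rewrite csum_const, minus_INR by lia. simpl.
    rewrite <- RtoC_mult. f_equal. ring.
  - intros t ht. unfold digit_coef.
    replace (S (b - 1 - 1 - t)) with (b - S t)%nat by lia.
    pose proof (one_minus_zeta_pow_neq_0 b (S t) ltac:(lia)) as h1.
    pose proof (one_minus_zeta_pow_neq_0 b (b - S t) ltac:(lia)) as h2.
    assert (e : (zeta b ^ S t * zeta b ^ (b - S t))%C = RtoC 1).
    { rewrite <- Cpow_add_r, <- (zeta_pow_b b hb). f_equal. lia. }
    set (u := (zeta b ^ S t)%C) in *. set (w := (zeta b ^ (b - S t))%C) in *.
    replace (u / (1 - u) + w / (1 - w))%C
      with ((u + w - u * w - u * w) / (1 - u - w + u * w))%C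
      by (field; repeat split; try assumption;
          intros e'; apply (Cmult_neq_0 _ _ h1 h2); rewrite <- e'; ring).
    assert (h3 : (1 - u - w + 1)%C <> RtoC 0).
    { rewrite <- e at 2. intros e'. apply (Cmult_neq_0 _ _ h1 h2).
      rewrite <- e'. ring. }
    rewrite e, RtoC_m1.
    field. exact h3. }
replace (csum (digit_coef b) (b - 1)) with
  (RtoC (/ 2) * (csum (digit_coef b) (b - 1) + csum (digit_coef b) (b - 1)))%C.
- rewrite h, <- RtoC_mult. f_equal. field.
- rewrite RtoC_inv by lra. field.
Qed.

(* The finite Fourier expansion of the identity on {0, ..., b - 1}: the
   difference in j of the right-hand side is a complete geometric sum. *)
Lemma digit_expansion (b j : nat) : (j < b)%nat -> (2 <= b)%nat ->
  RtoC (INR j) = (RtoC ((INR b - 1) / 2) +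
    csum (fun t => digit_coef b t * zeta b ^ (S t * j)) (b - 1))%C.
Proof.
intros hj hb. induction j as [|j IH].
- rewrite (csum_ext _ (digit_coef b)).
  + rewrite digit_coef_sum by assumption. rewrite <- RtoC_plus.
    f_equal. simpl. ring.
  + intros t _. rewrite Nat.mul_0_r. simpl. ring.
- rewrite S_INR, RtoC_plus, IH by lia. rewrite <- Cplus_assoc. f_equal.
  rewrite (csum_ext (fun t => digit_coef b t * zeta b ^ (S t * S j))%C
    (fun t => digit_coef b t * zeta b ^ (S t * j)
      + RtoC (-1) * (zeta b ^ S j) ^ S t)%C).
  + rewrite csum_plus. f_equal. rewrite csum_scal.
    assert (e : csum (fun i => (zeta b ^ S j) ^ i)%C (S (b - 1)) = RtoC 0)
      by (replace (S (b - 1)) with b by lia; apply zeta_geometric_sum; lia).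
    rewrite csum_first in e.
    set (s := csum (fun i => (zeta b ^ S j) ^ S i)%C (b - 1)) in *.
    replace s with (((zeta b ^ S j) ^ 0 + s) - 1)%C by (simpl; ring).
    rewrite e, RtoC_m1. ring.
  + intros t ht. unfold digit_coef.
    rewrite Nat.mul_succ_r, Cpow_add_r, <- Cpow_mult_r, (Nat.mul_comm (S j)).
    rewrite Nat.mul_succ_r, Cpow_add_r, RtoC_m1.
    field. apply one_minus_zeta_pow_neq_0. lia.
Qed.

(** * Walsh functions on the digit grid *)


Definition floor_at (b n : nat) (x : R) : nat := Z.to_nat (Int_part (INR b ^ n * x)).

Lemma xdigit_floor_at (b n : nat) (x : R) : xdigit b x n = (floor_at b n x mod b)%nat.
Proof. reflexivity. Qed.

Lemma floor_at_unique (b n m : nat) (x : R) :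
  INR m <= INR b ^ n * x < INR m + 1 -> floor_at b n x = m.
Proof.
intros h. pose proof (pos_INR m) as hm.
destruct (floor_bounds (INR b ^ n * x)) as [h1 h2]; [lra|].
fold (floor_at b n x) in h1, h2. set (u := floor_at b n x) in *.
assert (u < m + 1)%nat by (apply INR_lt; rewrite plus_INR; simpl; lra).
assert (m < u + 1)%nat by (apply INR_lt; rewrite plus_INR; simpl; lra).
lia.
Qed.

(** Each division by [b] removes the last digit added by [floor_step]. *)
Lemma floor_at_div (b n d : nat) (x : R) : (2 <= b)%nat -> 0 <= x ->
  (floor_at b (n + d) x / b ^ d)%nat = floor_at b n x.
Proof.
intros hb hx. induction d as [|d IH].
- rewrite Nat.add_0_r, Nat.pow_0_r, Nat.div_1_r. reflexivity.
- rewrite Nat.pow_succ_r', <- Nat.Div0.div_div, <- IH. f_equal.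
  unfold floor_at at 1. rewrite Nat.add_succ_r, floor_step by assumption.
  fold (floor_at b (n + d) x).
  assert (xdigit b x (S (n + d)) < b)%nat
    by (apply Nat.mod_upper_bound; lia).
  symmetry. apply (Nat.div_unique _ b _ (xdigit b x (S (n + d)))); lia.
Qed.

(* A positive integer is encoded by the list of the pairs (a_i, kappa_i), most
   significant digit first; prepending a pair amounts to adding a leading
   digit. *)
Definition lead (L : list (nat * nat)) : nat :=
  match L with nil => 0%nat | p :: _ => fst p end.

(** Since [lead nil = 0], the first condition at the last pair says that its position is
    positive. *)
Fixpoint expansion (b : nat) (L : list (nat * nat)) : Prop :=
  match L with
  | nil => True
  | p :: L' => (lead L' < fst p)%nat /\ (0 < snd p < b)%nat /\ expansion b L'
  end.

(** The conjugate of the Walsh function of the encoded integer. *)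
Definition cwal (b : nat) (L : list (nat * nat)) (x : R) : C :=
  (zeta b ^ list_sum (map (fun p => snd p * xdigit b x (fst p))%nat L))%C.

Lemma Cmod_cwal (b : nat) (L : list (nat * nat)) (x : R) : Cmod (cwal b L x) = 1.
Proof. apply Cmod_zeta_pow. Qed.

Lemma cwal_cons (b a k : nat) (L : list (nat * nat)) (x : R) :
  cwal b ((a, k) :: L) x = (cwal b L x * (zeta b ^ k) ^ xdigit b x a)%C.
Proof.
unfold cwal. simpl. rewrite Cpow_add_r, Cpow_mult_r. ring.
Qed.

(** Only digits at positions up to [n] enter, and these are determined by the index of the grid
    interval of length [b^-n]. The values [w] are defined at every index, so grid sums need no range
    conditions. *)
Lemma cwal_grid (b n : nat) (L : list (nat * nat)) : (2 <= b)%nat ->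
  expansion b L -> (lead L <= n)%nat ->
  exists w : nat -> C, (forall m, Cmod (w m) = 1) /\
    forall x, 0 <= x -> cwal b L x = w (floor_at b n x).
Proof.
intros hb hL hn. induction L as [|[a k] L IH].
- exists (fun _ => RtoC 1). split; intros; [apply Cmod_1 | reflexivity].
- simpl in hL, hn. destruct hL as (h1 & h2 & h3).
  destruct (IH h3) as (w & hw1 & hw2); [lia|].
  exists (fun m => w m * (zeta b ^ k) ^ ((m / b ^ (n - a)) mod b))%C.
  split; [intros m | intros x hx].
  + rewrite Cmod_mult, hw1, Cmod_pow, Cmod_zeta_pow, pow1. ring.
  + rewrite cwal_cons, hw2, xdigit_floor_at by assumption.
    rewrite <- (floor_at_div b a (n - a) x hb hx).
    replace (a + (n - a))%nat with n by lia. reflexivity.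
Qed.

Section Grid.

Variables (b a k : nat) (L : list (nat * nat)).
Hypothesis hb : (2 <= b)%nat.
Hypothesis hL : expansion b ((a, k) :: L).

Let h : R := / INR b ^ a.

Lemma grid_pos : 0 < h.
Proof.
apply Rinv_0_lt_compat, pow_lt, lt_0_INR. lia.
Qed.

Lemma grid_end : INR (b ^ a) * h = 1.
Proof.
unfold h. rewrite pow_INR. field. apply pow_nonzero, not_0_INR. lia.
Qed.

Lemma floor_at_grid (m : nat) (x : R) :
  INR m * h <= x < INR (S m) * h -> floor_at b a x = m.
Proof.
intros hx. pose proof grid_pos as hh. apply floor_at_unique.
assert (e : h * INR b ^ a = 1)
  by (unfold h; field; apply pow_nonzero, not_0_INR; lia).
assert (0 < INR b ^ a) by (apply pow_lt, lt_0_INR; lia).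
rewrite S_INR in hx. rewrite (Rmult_comm _ x).
replace (INR m) with (INR m * h * INR b ^ a) at 1
  by (rewrite Rmult_assoc, e; ring).
replace (INR m + 1) with ((INR m + 1) * h * INR b ^ a)
  by (rewrite Rmult_assoc, e; ring).
split; [apply Rmult_le_compat_r | apply Rmult_lt_compat_r]; lra.
Qed.

(* [cwal_sum] is the sum of the values of [cwal] over the grid intervals to the
   left of the one containing [x]. *)
Definition cwal_sum (x : R) : C :=
  (/ (1 - zeta b ^ k) * (cwal b L x - cwal b ((a, k) :: L) x))%C.

(** The first term collects the complete grid intervals to the left of [x], the second the interval
    that contains [x]. *)
Definition cwal_primitive (x : R) : C :=
  (RtoC h * cwal_sum x
   + RtoC (x - INR (floor_at b a x) * h) * cwal b ((a, k) :: L) x)%C.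

(** Over a block of [b] consecutive grid intervals only the digit at position [a] varies, so the
    values [E] run through a geometric progression of ratio [zeta b ^ k]. Their partial sums [S]
    therefore return to zero after each block, in particular at [b ^ a], and stay below [b / 2] in
    between. *)
Lemma grid_values : exists E S : nat -> C,
  (forall m, Cmod (E m) = 1) /\ (forall m, Cmod (S m) <= INR (b / 2)) /\
  (forall m, S (Datatypes.S m) = (S m + E m)%C) /\
  S O = RtoC 0 /\ S (b ^ a)%nat = RtoC 0 /\
  (forall x, 0 <= x -> cwal b ((a, k) :: L) x = E (floor_at b a x)) /\
  (forall x, 0 <= x -> cwal_sum x = S (floor_at b a x)).
Proof.
destruct hL as (h1 & h2 & h3). simpl in h1, h2.
(* All positions in [L] are below [a], so its function is constant on the coarser intervals of
   length [b^(1 - a)]. *)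
destruct (cwal_grid b (a - 1) L hb h3 ltac:(lia)) as (w & hw1 & hw2).
set (g := csum (fun i => (zeta b ^ k) ^ i)%C).
assert (hz : (1 - zeta b ^ k)%C <> RtoC 0)
  by (apply one_minus_zeta_pow_neq_0; lia).
assert (hzb : ((zeta b ^ k) ^ b)%C = RtoC 1).
{ rewrite <- Cpow_mult_r, Nat.mul_comm, Cpow_mult_r, zeta_pow_b, Cpow_1_l
    by assumption. reflexivity. }
assert (hgb : g b = RtoC 0) by (apply zeta_geometric_sum; lia).
assert (hbnd : forall m, (m mod b < b)%nat)
  by (intros; apply Nat.mod_upper_bound; lia).
assert (hE : forall x, 0 <= x -> cwal b ((a, k) :: L) x =
  (w (floor_at b a x / b)%nat * (zeta b ^ k) ^ (floor_at b a x mod b))%C).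
{ intros x hx. rewrite cwal_cons, hw2, xdigit_floor_at by assumption.
  rewrite <- (floor_at_div b (a - 1) 1 x hb hx).
  replace (a - 1 + 1)%nat with a by lia. rewrite Nat.pow_1_r. reflexivity. }
exists (fun m => w (m / b)%nat * (zeta b ^ k) ^ (m mod b))%C.
exists (fun m => w (m / b)%nat * g (m mod b)%nat)%C.
repeat split.
- intros m. rewrite Cmod_mult, hw1, Cmod_pow, Cmod_zeta_pow, pow1. ring.
- intros m. rewrite Cmod_mult, hw1, Rmult_1_l.
  apply zeta_partial_geometric_sum; [lia|]. specialize (hbnd m). lia.
- intros m. specialize (hbnd m).
  pose proof (Nat.div_mod_eq m b) as em.
  set (q := (m / b)%nat) in *. set (j := (m mod b)%nat) in *.
  (* At the end of a block [g b = 0], which absorbs the change of [w] from one block to the next. *)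
  destruct (Nat.eq_dec (S j) b) as [e|e].
  + replace (S m / b)%nat with (S q)
      by (apply (Nat.div_unique _ b _ 0); lia).
    replace (S m mod b)%nat with 0%nat
      by (apply (Nat.mod_unique _ b (S q)); lia).
    transitivity (w q * g (S j))%C.
    * rewrite e, hgb. unfold g. cbn [csum]. ring.
    * unfold g. cbn [csum]. ring.
  + replace (S m / b)%nat with q
      by (apply (Nat.div_unique _ b _ (S j)); lia).
    replace (S m mod b)%nat with (S j)
      by (apply (Nat.mod_unique _ b q); lia).
    unfold g. cbn [csum]. ring.
- rewrite Nat.Div0.mod_0_l. unfold g. cbn [csum]. ring.
- replace (b ^ a mod b)%nat with 0%nat.
  + unfold g. cbn [csum]. ring.
  + apply (Nat.mod_unique _ b (b ^ (a - 1))); [lia|].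
    rewrite Nat.add_0_r, <- Nat.pow_succ_r'. f_equal. lia.
- exact hE.
- intros x hx. unfold cwal_sum. rewrite hE by assumption.
  rewrite hw2, <- (floor_at_div b (a - 1) 1 x hb hx) by assumption.
  replace (a - 1 + 1)%nat with a by lia. rewrite Nat.pow_1_r.
  set (j := (floor_at b a x mod b)%nat).
  pose proof (csum_power_step (zeta b ^ k) j) as e. fold (g j) in e.
  replace (g j) with ((1 - zeta b ^ k) * g j / (1 - zeta b ^ k))%C
    by (field; exact hz).
  rewrite e. field. exact hz.
Qed.

Lemma ex_RIntC_cwal (f : R -> R) : (forall x, continuous f x) ->
  exists l, is_RIntC (fun x => RtoC (f x) * cwal b ((a, k) :: L) x)%C 0 1 l.
Proof.
intros hf. destruct grid_values as (E & S & _ & _ & _ & _ & _ & hE & _).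
assert (H : forall m, exists l,
  is_RIntC (fun x => RtoC (f x) * cwal b ((a, k) :: L) x)%C 0 (INR m * h) l).
{ pose proof grid_pos as hh. induction m as [|m [l IH]].
  - exists (RtoC 0). simpl. rewrite Rmult_0_l. apply (is_RInt_point (V := C_R_NormedModule)).
  - assert (hi : ex_RInt f (INR m * h) (INR (Datatypes.S m) * h))
      by (apply (ex_RInt_continuous (V := R_CompleteNormedModule)); auto).
    destruct hi as [l' hl'].
    exists (l + E m * RtoC l')%C. eapply is_RIntC_Chasles; [exact IH|].
    pose proof (pos_INR m). rewrite S_INR in *.
    apply (is_RIntC_ext (fun x => E m * RtoC (f x))%C); [nra| |].
    + intros x hx. rewrite hE by nra.
      rewrite (floor_at_grid m) by (rewrite S_INR; lra). ring.
    + apply is_RIntC_scal, is_RIntC_pair; [exact hl'|].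
      apply (is_RInt_ext (fun _ => 0)); [reflexivity|].
      pose proof (is_RInt_const (INR m * h) ((INR m + 1) * h) 0) as h0.
      unfold scal in h0; simpl in h0; unfold mult in h0; simpl in h0.
      rewrite Rmult_0_r in h0. exact h0. }
destruct (H (b ^ a)%nat) as [l hl]. exists l. rewrite grid_end in hl. exact hl.
Qed.

(** On each grid interval the integrand is the derivative of [f] times the primitive. The primitive
    is continuous across grid points and vanishes at 0 and 1, so the contributions telescope to
    zero. Both terms stay under one integral, which makes integrability part of the telescoping. *)
Lemma cwal_integration_by_parts (f g : R -> R) :
  (forall x, is_derive f x (g x)) -> (forall x, continuous g x) ->
  is_RIntC (fun x => RtoC (f x) * cwal b ((a, k) :: L) x
                     + RtoC (g x) * cwal_primitive x)%C 0 1 (RtoC 0).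
Proof.
intros hf hg. destruct grid_values as (E & S & _ & _ & hS & hS0 & hSN & hE & hSx).
assert (hfc : forall x, continuous f x).
{ intros x. apply (ex_derive_continuous (K := R_AbsRing) (V := R_NormedModule)).
  eexists. apply hf. }
(* The integral up to the grid point [m h] is the boundary term there, the primitive having the
   value [h * S m]. *)
assert (H : forall m, is_RIntC
  (fun x => RtoC (f x) * cwal b ((a, k) :: L) x + RtoC (g x) * cwal_primitive x)%C
  0 (INR m * h) (RtoC (f (INR m * h)%R * h) * S m)%C).
{ pose proof grid_pos as hh. induction m as [|m IH].
  - simpl. rewrite Rmult_0_l, hS0, Cmult_0_r.
    apply (is_RInt_point (V := C_R_NormedModule)).
  - pose proof (pos_INR m) as hm.
    set (p := INR m * h) in *. set (p' := INR (Datatypes.S m) * h).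
    assert (hp : p' = p + h) by (unfold p, p'; rewrite S_INR; ring).
    assert (hp0 : 0 <= p) by (unfold p; nra).
    apply (is_RIntC_eq _ _ _
      (RtoC (f p * h) * S m
       + (RtoC (f p') * (RtoC h * S m + RtoC (p' - p) * E m) - RtoC (f p * h) * S m))%C).
    2: { rewrite hS, !RtoC_mult. replace (p' - p) with h by lra. ring. }
    eapply is_RIntC_Chasles; [exact IH|].
    apply (is_RIntC_ext (fun x => RtoC (f x) * E m
      + RtoC (g x) * (RtoC h * S m + RtoC (x - p) * E m))%C); [lra| |].
    { intros x hx. unfold cwal_primitive. rewrite hE, hSx by lra.
      rewrite (floor_at_grid m) by (fold p p'; lra). reflexivity. }
    (* A real version, to be used with the real and then the imaginary parts of [S m] and [E m]. *)
    assert (D : forall s e : R, is_RInt (fun x => f x * e + g x * (h * s + (x - p) * e))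
      p p' (f p' * (h * s + (p' - p) * e) - f p * (h * s))).
    { intros s e.
      replace (f p' * (h * s + (p' - p) * e) - f p * (h * s)) with
        (minus (f p' * (h * s + (p' - p) * e)) (f p * (h * s + (p - p) * e)))
        by (unfold minus, plus, opp; simpl; ring).
      apply (is_RInt_derive (fun x => f x * (h * s + (x - p) * e))).
      - intros x _. pose proof (hf x) as hx.
        auto_derive; [exists (g x); exact hx|].
        replace (Derive (fun y => f y) x) with (g x)
          by (symmetry; apply is_derive_unique, hx). ring.
      - intros x _. apply (continuous_plus (V := R_NormedModule)).
        + apply (continuous_mult (K := R_AbsRing)); [apply hfc | apply continuous_const].
        + apply (continuous_mult (K := R_AbsRing)); [apply hg|].
          apply (ex_derive_continuous (K := R_AbsRing) (V := R_NormedModule)).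
          auto_derive. exact I. }
    apply is_RIntC_pair.
    + eapply is_RInt_ext; [|eapply eq_rect; [apply (D (fst (S m)) (fst (E m)))|]].
      * intros x _. simpl. ring.
      * simpl. ring.
    + eapply is_RInt_ext; [|eapply eq_rect; [apply (D (snd (S m)) (snd (E m)))|]].
      * intros x _. simpl. ring.
      * simpl. ring. }
specialize (H (b ^ a)%nat). rewrite grid_end, hSN, Cmult_0_r in H. exact H.
Qed.

End Grid.

(** * The variation bound *)


Definition cwal_coef (b : nat) (L : list (nat * nat)) (f : R -> R) : C :=
  RInt (V := C_R_CompleteNormedModule)
    (fun x => Cmult (RtoC (f x)) (cwal b L x)) 0 1.

Lemma cwal_coef_correct (b : nat) (L : list (nat * nat)) (f : R -> R) :
  (2 <= b)%nat -> expansion b L -> (forall x, continuous f x) ->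
  is_RIntC (fun x => RtoC (f x) * cwal b L x)%C 0 1 (cwal_coef b L f).
Proof.
intros hb hL hf.
apply (RInt_correct (V := C_R_CompleteNormedModule)).
destruct L as [|[a k] L]; [|exact (ex_RIntC_cwal b a k L hb hL f hf)].
destruct (ex_RInt_continuous (V := R_CompleteNormedModule) f 0 1) as [l hl];
  [auto|].
exists (RtoC l). apply (is_RIntC_ext (fun x => RtoC (f x))); [lra| |].
- intros x _. unfold cwal. simpl. ring.
- apply is_RIntC_real, hl.
Qed.

Lemma cwal_coef_nil (b : nat) (f : R -> R) : (forall x, continuous f x) ->
  cwal_coef b nil f = RtoC (RInt f 0 1).
Proof.
intros hf. apply (is_RInt_unique (V := C_R_CompleteNormedModule)).
apply (is_RIntC_ext (fun x => RtoC (f x))); [lra| |].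
- intros x _. unfold cwal. simpl. ring.
- apply is_RIntC_real, (RInt_correct (V := R_CompleteNormedModule)).
  apply (ex_RInt_continuous (V := R_CompleteNormedModule)). auto.
Qed.

(** Abel summation, [S] being the sequence of partial sums of [E]. *)
Lemma csum_by_parts (E S : nat -> C) (u : nat -> R) (n : nat) :
  (forall m, S (Datatypes.S m) = (S m + E m)%C) -> S O = RtoC 0 ->
  csum (fun i => E i * RtoC (u i))%C (Datatypes.S n) =
  (S (Datatypes.S n) * RtoC (u n)
   - csum (fun i => S (Datatypes.S i) * RtoC (u (Datatypes.S i) - u i)) n)%C.
Proof.
intros hS h0. induction n as [|n IH].
- cbn [csum]. rewrite hS, h0. ring.
- change (csum (fun i => E i * RtoC (u i))%C (Datatypes.S (Datatypes.S n))) with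
    (csum (fun i => E i * RtoC (u i)) (Datatypes.S n)
     + E (Datatypes.S n) * RtoC (u (Datatypes.S n)))%C.
  rewrite IH, (hS (Datatypes.S n)). cbn [csum]. rewrite RtoC_minus. ring.
Qed.

Lemma csum_weighted_bound (S : nat -> C) (u : nat -> R) (K : R) (n : nat) :
  (forall m, Cmod (S m) <= K) ->
  Cmod (csum (fun i => S (Datatypes.S i) * RtoC (u (Datatypes.S i) - u i))%C n)
  <= K * sum_n_m (fun i => Rabs (u i - u (i - 1)%nat)) 1 n.
Proof.
intros hS. induction n as [|n IH].
- rewrite sum_n_m_zero by lia. cbn [csum]. rewrite Cmod_0.
  unfold zero; simpl. lra.
- rewrite sum_n_Sm by lia. cbn [csum].
  replace (Datatypes.S n - 1)%nat with n by lia.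
  unfold plus; simpl.
  eapply Rle_trans; [apply Cmod_triangle|]. rewrite Rmult_plus_distr_l.
  apply Rplus_le_compat; [exact IH|].
  rewrite Cmod_mult, Cmod_R. apply Rmult_le_compat_r; [apply Rabs_pos | apply hS].
Qed.

(** A real bound for all variation sums, which keeps the extended reals of [variation] out of the
    estimates. *)
Definition variation_bound (lambda : R) (g : R -> R) (V : R) : Prop :=
  forall N x, is_partition01 N x -> variation_sum lambda g N x <= V.

Lemma sum_n_m_last (u : nat -> R) (m n : nat) : (m <= S n)%nat ->
  sum_n_m u m (S n) = sum_n_m u m n + u (S n).
Proof. exact (sum_n_Sm u m n). Qed.

Lemma sum_n_m_nonneg (u : nat -> R) (m n : nat) :
  (forall i, 0 <= u i) -> 0 <= sum_n_m u m n.
Proof.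
intros hu. destruct (Nat.le_gt_cases m n) as [h|h].
- induction h as [|n h IH]; [rewrite sum_n_n; apply hu|].
  rewrite sum_n_m_last by lia. specialize (hu (S n)). lra.
- rewrite sum_n_m_zero by lia. apply Rle_refl.
Qed.

(* The points t + i h form, together with 0 and 1, a partition of [0,1]. *)
Lemma uniform_increments_bound (lambda V h t : R) (g : R -> R) (N : nat) :
  variation_bound lambda g V -> 0 < t < h -> INR (S N) * h = 1 ->
  sum_n_m (fun i => Rabs (g (t + INR i * h) - g (t + INR (i - 1) * h))) 1 N
    * (h / Rpower h lambda) <= V.
Proof.
intros hV ht hN.
(* The points are 0, then the [S N] points [t + i h] with [i <= N], then 1, hence [S (S N)]
   subintervals. The last shifted point is below 1 because [t < h]. *)
set (x := fun i => if (i =? 0)%nat then 0 else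
  if (i <=? S N)%nat then t + INR (i - 1) * h else 1).
assert (hx : forall i, (i <= N)%nat -> x (S i) = t + INR i * h).
{ intros i hi. unfold x. cbn [Nat.eqb].
  rewrite (proj2 (Nat.leb_le (S i) (S N))) by lia.
  replace (S i - 1)%nat with i by lia. reflexivity. }
assert (hx1 : x (S (S N)) = 1).
{ unfold x. cbn [Nat.eqb].
  rewrite (proj2 (Nat.leb_gt (S (S N)) (S N))) by lia. reflexivity. }
assert (hp : is_partition01 (S (S N)) x).
{ split; [reflexivity | split; [exact hx1|]].
  intros n hn. destruct n as [|n].
  - rewrite hx by lia. unfold x; simpl. lra.
  - rewrite hx by lia. destruct (Nat.eq_dec n N) as [->|e].
    + rewrite hx1. rewrite S_INR in hN. lra.
    + rewrite hx by lia. rewrite S_INR. lra. }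
specialize (hV _ _ hp). unfold variation_sum in hV.
set (T := fun n => Rabs (x n - x (n - 1)%nat) *
  (Rabs (g (x n) - g (x (n - 1)%nat)) /
   Rpower (Rabs (x n - x (n - 1)%nat)) lambda)) in hV.
assert (hT : forall n, 0 <= T n).
{ intros n. unfold T, Rdiv. repeat apply Rmult_le_pos; try apply Rabs_pos.
  left. apply Rinv_0_lt_compat, exp_pos. }
rewrite sum_n_m_last in hV by lia.
(* The first and the last subinterval are dropped as nonnegative terms. All others have length
   exactly [h], so the weight [h / h^lambda] factors out. *)
assert (H : forall n, (n <= N)%nat ->
  sum_n_m (fun i => Rabs (g (t + INR i * h) - g (t + INR (i - 1) * h))) 1 n
    * (h / Rpower h lambda) <= sum_n_m T 1 (S n)).
{ induction n as [|n IH]; intros hn.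
  - rewrite sum_n_m_zero, sum_n_n by lia. unfold zero; simpl.
    rewrite Rmult_0_l. apply hT.
  - rewrite !sum_n_m_last by lia.
    rewrite Rmult_plus_distr_r. apply Rplus_le_compat.
    + specialize (IH ltac:(lia)). rewrite sum_n_m_last in IH by lia. exact IH.
    + right. unfold T. rewrite !Nat.sub_succ, !Nat.sub_0_r.
      rewrite (hx (S n)), (hx n) by lia. rewrite (S_INR n).
      replace (t + (INR n + 1) * h - (t + INR n * h)) with h by ring.
      rewrite (Rabs_pos_eq h) by lra. unfold Rdiv. ring. }
specialize (H N (Nat.le_refl N)). specialize (hT (S (S N))).
lra.
Qed.

(** Folding the integral onto [(0, h)] turns it into the integral of the grid sum of
    [E i * f (t + i h)]. Abel summation leaves increments of step [h] with weights at most [b / 2],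
    the variation bounds their sum by [V h^(lambda - 1)], and integrating over [(0, h)] supplies the
    last factor [h]. *)
Lemma cwal_coef_variation_bound (b a k : nat) (L : list (nat * nat))
  (f : R -> R) (lambda V : R) :
  (2 <= b)%nat -> expansion b ((a, k) :: L) -> (forall x, continuous f x) ->
  variation_bound lambda f V ->
  Cmod (cwal_coef b ((a, k) :: L) f) <=
  INR (b / 2) * V * Rpower (/ INR b ^ a) lambda.
Proof.
intros hb hL hf hV.
pose proof (cwal_coef_correct b _ f hb hL hf) as hI.
destruct (grid_values b a k L hb hL) as (E & S & hE1 & hS1 & hS & hS0 & hSN & hE & _).
pose proof (grid_pos b a hb) as hh. pose proof (grid_end b a hb) as hN.
pose proof (floor_at_grid b a hb) as hfl.
set (h := / INR b ^ a) in *.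
destruct (b ^ a)%nat as [|N] eqn:eN; [simpl in hN; lra|].
(* The integral over [[0, m h]] and the folded integral over [[0, h]] are built together, with the
   same value [l]. *)
assert (H : forall m, exists l,
  is_RIntC (fun x => RtoC (f x) * cwal b ((a, k) :: L) x)%C 0 (INR m * h) l /\
  is_RIntC (fun t => csum (fun i => E i * RtoC (f (t + INR i * h)%R))%C m) 0 h l).
{ induction m as [|m (l & IH1 & IH2)].
  - exists (RtoC 0). split; [|apply is_RIntC_zero].
    simpl. rewrite Rmult_0_l. apply (is_RInt_point (V := C_R_NormedModule)).
  - assert (hi : ex_RInt f (INR m * h) (INR (Datatypes.S m) * h))
      by (apply (ex_RInt_continuous (V := R_CompleteNormedModule)); auto).
    destruct hi as [l' hl']. pose proof (pos_INR m) as hm.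
    exists (l + E m * RtoC l')%C. split.
    + eapply is_RIntC_Chasles; [exact IH1|].
      apply (is_RIntC_ext (fun x => E m * RtoC (f x))%C); [rewrite S_INR; nra| |].
      * intros x hx. rewrite hE by nra. rewrite (hfl m) by lra. ring.
      * apply is_RIntC_scal, is_RIntC_real, hl'.
    + cbn [csum]. apply is_RIntC_plus; [exact IH2|].
      apply (is_RIntC_scal (E m) (fun t => RtoC (f (t + INR m * h)%R))).
      apply is_RIntC_real.
      replace (INR m * h) with (1 * 0 + INR m * h) in hl' by ring.
      replace (INR (Datatypes.S m) * h) with (1 * h + INR m * h) in hl'
        by (rewrite S_INR; ring).
      apply (is_RInt_ext (fun t => scal 1 (f (1 * t + INR m * h)))).
      * intros x _. change (1 * f (1 * x + INR m * h) = f (x + INR m * h)).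
        rewrite !Rmult_1_l. reflexivity.
      * exact (is_RInt_comp_lin f 1 (INR m * h) 0 h l' hl'). }
destruct (H (Datatypes.S N)) as (l & H1 & H2). rewrite hN in H1.
rewrite (is_RIntC_unique _ _ _ _ _ hI H1).
assert (hP : 0 < Rpower h lambda) by apply exp_pos.
assert (hB : forall t, 0 < t < h ->
  Cmod (csum (fun i => E i * RtoC (f (t + INR i * h)%R))%C (Datatypes.S N))
  <= INR (b / 2) * (V * (Rpower h lambda / h))).
{ intros t ht.
  rewrite (csum_by_parts E S (fun i => f (t + INR i * h)%R)) by assumption.
  (* The boundary term of the Abel summation vanishes, as the values over the whole grid sum to
     zero. *)
  rewrite hSN. unfold Cminus. rewrite Cmult_0_l, Cplus_0_l, Cmod_opp.
  eapply Rle_trans; [exact (csum_weighted_bound S (fun i => f (t + INR i * h)%R) _ N hS1)|].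
  apply Rmult_le_compat_l; [apply pos_INR|].
  pose proof (uniform_increments_bound lambda V h t f N hV ht hN) as hu.
  set (s := sum_n_m _ 1 N) in *.
  replace s with (s * (h / Rpower h lambda) * (Rpower h lambda / h))
    by (field; lra).
  apply Rmult_le_compat_r; [|exact hu].
  left. apply Rdiv_lt_0_compat; assumption. }
replace (INR (b / 2) * V * Rpower h lambda)
  with ((h - 0) * (INR (b / 2) * (V * (Rpower h lambda / h)))) by (field; lra).
apply (is_RIntC_bound _ _ _ _ _ (Rlt_le _ _ hh) hB); [|exact H2].
eapply Rle_trans; [apply Cmod_ge_0 | apply (hB (h / 2)); lra].
Qed.

(** The remainder is kept exactly, so that all sums stay finite and a limit is needed only for
    inequalities between reals. *)
Lemma frac_digits (b a n : nat) (x : R) : (2 <= b)%nat -> 0 <= x ->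
  RtoC (INR b ^ a * x - INR (floor_at b a x)) =
  (csum (fun c => RtoC ((/ INR b) ^ S c) * RtoC (INR (xdigit b x (a + S c)))) n
   + RtoC ((/ INR b) ^ n * (INR b ^ (a + n) * x - INR (floor_at b (a + n) x))))%C.
Proof.
intros hb hx. assert (hb0 : INR b <> 0) by (apply not_0_INR; lia).
induction n as [|n IH].
- cbn [csum]. rewrite Nat.add_0_r, pow_O, Rmult_1_l. ring.
- rewrite IH. cbn [csum]. rewrite <- Cplus_assoc. f_equal.
  rewrite <- RtoC_mult, <- RtoC_plus. f_equal.
  rewrite !Nat.add_succ_r.
  assert (e : floor_at b (S (a + n)) x =
    (b * floor_at b (a + n) x + xdigit b x (S (a + n)))%nat)
    by (apply floor_step; assumption).
  rewrite e, plus_INR, mult_INR, !pow_inv. simpl. field.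
  split; [apply pow_nonzero|]; exact hb0.
Qed.

Lemma floor_at_bounds (b n : nat) (x : R) : 0 <= x ->
  0 <= INR b ^ n * x - INR (floor_at b n x) < 1.
Proof.
intros hx. destruct (floor_bounds (INR b ^ n * x)) as [h1 h2].
- apply Rmult_le_pos; [apply pow_le, pos_INR | exact hx].
- fold (floor_at b n x) in h1, h2. lra.
Qed.

(** * The recursion between coefficients of a function and of its derivative *)


(** The part of the fractional part of [b^a x], times the Walsh function of [L], that comes from the
    nontrivial characters of its first [n] digits. A character of one digit becomes a new leading
    pair. *)
Definition cwal_tail (b a : nat) (L : list (nat * nat)) (n : nat) (x : R) : C :=
  csum (fun c => RtoC ((/ INR b) ^ S c) *
    csum (fun t => digit_coef b t * cwal b ((a + S c, S t)%nat :: L) x) (b - 1))%C n.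

(** Each digit is replaced by its Fourier expansion. The means [(b - 1) / 2], weighted by [b^-c] for
    [c] from 1 to [n], add up to [(1 - b^-n) / 2]. *)
Lemma cwal_digits (b a n : nat) (L : list (nat * nat)) (x : R) : (2 <= b)%nat ->
  (csum (fun c => RtoC ((/ INR b) ^ S c) * RtoC (INR (xdigit b x (a + S c)))) n
   * cwal b L x)%C =
  (RtoC ((1 - (/ INR b) ^ n) / 2) * cwal b L x + cwal_tail b a L n x)%C.
Proof.
intros hb. assert (hb0 : INR b <> 0) by (apply not_0_INR; lia).
unfold cwal_tail. induction n as [|n IH].
- cbn [csum]. rewrite pow_O. replace ((1 - 1) / 2) with 0 by field. ring.
- cbn [csum]. rewrite Cmult_plus_distr_r, IH.
  rewrite (digit_expansion b (xdigit b x (a + S n)))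
    by (try apply Nat.mod_upper_bound; lia).
  replace (RtoC ((1 - (/ INR b) ^ S n) / 2)) with
    (RtoC ((1 - (/ INR b) ^ n) / 2) + RtoC ((/ INR b) ^ S n) * RtoC ((INR b - 1) / 2))%C
    by (rewrite <- RtoC_mult, <- RtoC_plus; f_equal; simpl; field; exact hb0).
  replace (csum (fun t => digit_coef b t * cwal b ((a + S n, S t)%nat :: L) x)%C (b - 1))
    with (cwal b L x * csum (fun t => digit_coef b t *
      zeta b ^ (S t * xdigit b x (a + S n))) (b - 1))%C; [ring|].
  rewrite <- csum_scal. apply csum_ext. intros t _.
  rewrite cwal_cons, Cpow_mult_r. ring.
Qed.

(** Records whether the Walsh function itself can occur in its own primitive. For [b = 2] its
    coefficient [1/2 - 1/(1 - zeta b ^ k)] is zero, because [k = 1] and [zeta 2 = -1]. *)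
Definition middle_factor (b : nat) : R := if (b =? 2)%nat then 0 else 1.

(** The coefficient equals [-(1 + z) / 2] divided by [1 - z] with [z = zeta b ^ k], and the
    numerator has modulus at most 1. *)
Lemma middle_coef_bound (b k : nat) : (0 < k < b)%nat ->
  Cmod (/ 2 - / (1 - zeta b ^ k)) <= middle_factor b * / (2 * sin (PI / INR b)).
Proof.
intros hk. pose proof (one_minus_zeta_pow_neq_0 b k hk) as hz.
assert (h2 : RtoC 2 <> RtoC 0) by (intros e; apply (f_equal fst) in e; simpl in e; lra).
unfold middle_factor. destruct (Nat.eqb_spec b 2) as [->|e].
- replace k with 1%nat by lia. rewrite Cpow_1_r, zeta_two.
  replace (/ 2 - / (1 - - (1)))%C with (RtoC 0).
  + rewrite Cmod_0. lra.
  + replace (1 - - (1))%C with (RtoC 2); [ring|].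
    unfold Cminus, Copp, Cplus, RtoC; simpl. f_equal; ring.
- replace (/ 2 - / (1 - zeta b ^ k))%C with
    ((- (1 + zeta b ^ k) / 2) / (1 - zeta b ^ k))%C by (field; auto).
  eapply Rle_trans; [apply Cmod_div_one_minus_zeta_pow; exact hk|].
  pose proof (sin_PI_div_pos b ltac:(lia)) as hs.
  apply Rmult_le_compat_r; [left; apply Rinv_0_lt_compat; lra|].
  rewrite Cmod_div, Cmod_opp by exact h2.
  pose proof (Cmod_triangle 1 (zeta b ^ k)) as ht.
  rewrite Cmod_1, Cmod_zeta_pow in ht. rewrite Cmod_R, (Rabs_pos_eq 2) by lra. lra.
Qed.

Lemma continuous_bounded (g : R -> R) : (forall x, continuous g x) ->
  exists M, 0 <= M /\ forall x, 0 <= x <= 1 -> Rabs (g x) <= M.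
Proof.
intros hg.
destruct (continuity_ab_maj (fun x => Rabs (g x)) 0 1) as [m [hm _]]; [lra| |].
- intros x _. apply continuity_pt_filterlim.
  apply (continuous_comp g Rabs); [apply hg|]. apply continuous_Rabs.
- exists (Rabs (g m)). split; [apply Rabs_pos | exact hm].
Qed.

(** Integration by parts, with the primitive expanded into Walsh functions by [cwal_digits]. The
    error [r] of stopping after [n] digits is controlled by a bound [M] of the derivative that does
    not depend on [n]. *)
Lemma cwal_coef_identity (b a k : nat) (L : list (nat * nat)) (f g : R -> R) :
  (2 <= b)%nat -> expansion b ((a, k) :: L) ->
  (forall x, is_derive f x (g x)) -> (forall x, continuous g x) ->
  exists M, 0 <= M /\ forall n, exists r, Cmod r <= M * (/ INR b) ^ n /\
  cwal_coef b ((a, k) :: L) f = (- RtoC (/ INR b ^ a) *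
    (/ (1 - zeta b ^ k) * cwal_coef b L g
     + (/ 2 - / (1 - zeta b ^ k)) * cwal_coef b ((a, k) :: L) g
     + csum (fun c => RtoC ((/ INR b) ^ S c) * csum (fun t => digit_coef b t *
         cwal_coef b ((a + S c, S t)%nat :: (a, k) :: L) g) (b - 1)) n + r))%C.
Proof.
intros hb hL hf hg. assert (hL' := hL). destruct hL' as (h1 & h2 & h3).
simpl in h1, h2.
assert (hfc : forall x, continuous f x).
{ intros x. apply (ex_derive_continuous (K := R_AbsRing) (V := R_NormedModule)).
  eexists. apply hf. }
assert (hb0 : 2 <= INR b) by (apply (le_INR 2); lia).
destruct (continuous_bounded g hg) as (M & hM0 & hM).
exists M. split; [exact hM0|]. intros n.
set (L0 := (a, k) :: L) in *.
set (Q := (/ (1 - zeta b ^ k))%C). set (p := INR b ^ a). set (y := (/ INR b) ^ n).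
assert (hp : 0 < p) by (apply pow_lt; lra).
assert (hy : 0 < y) by (apply pow_lt, Rinv_0_lt_compat; lra).
pose proof (cwal_integration_by_parts b a k L hb hL f g hf hg) as hJ.
pose proof (cwal_coef_correct b L0 f hb hL hfc) as hI0.
pose proof (cwal_coef_correct b L g hb h3 hg) as hI1.
pose proof (cwal_coef_correct b L0 g hb hL hg) as hI2.
assert (hI3 : is_RIntC (fun x => csum (fun c => RtoC ((/ INR b) ^ S c) *
    csum (fun t => digit_coef b t *
      (RtoC (g x) * cwal b ((a + S c, S t)%nat :: L0) x)) (b - 1))%C n) 0 1
  (csum (fun c => RtoC ((/ INR b) ^ S c) * csum (fun t => digit_coef b t *
         cwal_coef b ((a + S c, S t)%nat :: L0) g) (b - 1))%C n)).
{ apply is_RIntC_csum. intros c _. apply is_RIntC_scal.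
  apply is_RIntC_csum. intros t ht. apply is_RIntC_scal.
  apply cwal_coef_correct; [assumption | | assumption].
  split; [|split]; [simpl; lia | simpl; lia | exact hL]. }
set (I0 := cwal_coef b L0 f) in *. set (I1 := cwal_coef b L g) in *.
set (I2 := cwal_coef b L0 g) in *. set (I3 := csum _ n) in hI3 |- *.
(* The error is obtained by solving the identity for it; the estimate follows by recognising it as
   the integral of [rem]. *)
exists (- RtoC p * I0 - Q * I1 - (/ 2 - Q) * I2 - I3)%C. split.
2: { assert (e : (RtoC (/ p) * RtoC p)%C = RtoC 1)
       by (rewrite <- RtoC_mult; f_equal; field; lra).
     transitivity (RtoC (/ p) * RtoC p * I0)%C; [rewrite e; ring | ring]. }
(* The truncation leaves [y] times the fractional part of [b^(a + n) x], and the mean [(1 - y) / 2]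
   falls short of [1/2] by [y / 2]. *)
set (rem := fun x => (RtoC (g x * (y * (INR b ^ (a + n) * x
  - INR (floor_at b (a + n) x)) - y / 2)) * cwal b L0 x)%C).
apply Rle_trans with ((1 - 0) * (M * y)); [|lra].
apply (is_RIntC_bound rem); [lra| |nra|].
- intros x hx. unfold rem. rewrite Cmod_mult, Cmod_cwal, Rmult_1_r, Cmod_R, Rabs_mult.
  apply Rmult_le_compat; try apply Rabs_pos; [apply hM; lra|].
  pose proof (floor_at_bounds b (a + n) x ltac:(lra)) as hfl.
  apply Rabs_le. nra.
- apply (is_RIntC_ext (fun x =>
    RtoC p * (RtoC (f x) * cwal b L0 x + RtoC (g x) * cwal_primitive b a k L x)
    + (- RtoC p * (RtoC (f x) * cwal b L0 x)
    + (- Q * (RtoC (g x) * cwal b L x)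
    + (- (/ 2 - Q) * (RtoC (g x) * cwal b L0 x)
    + - (1) * csum (fun c => RtoC ((/ INR b) ^ S c) *
      csum (fun t => digit_coef b t *
      (RtoC (g x) * cwal b ((a + S c, S t)%nat :: L0) x)) (b - 1)) n))))%C); [lra| |].
  + intros x hx.
    replace (csum (fun c => RtoC ((/ INR b) ^ S c) *
      csum (fun t => digit_coef b t *
      (RtoC (g x) * cwal b ((a + S c, S t)%nat :: L0) x)) (b - 1))%C n)
      with (RtoC (g x) * cwal_tail b a L0 n x)%C.
    2: { unfold cwal_tail. rewrite <- csum_scal. apply csum_ext. intros c _.
         transitivity (RtoC ((/ INR b) ^ S c) * (RtoC (g x) *
           csum (fun t => digit_coef b t * cwal b ((a + S c, S t)%nat :: L0) x) (b - 1)))%C;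
           [ring|].
         f_equal. rewrite <- csum_scal. apply csum_ext. intros t _. ring. }
    pose proof (cwal_digits b a n L0 x hb) as hd.
    pose proof (frac_digits b a n x hb ltac:(lra)) as hfr.
    fold p in hfr. fold y in hd, hfr.
    set (T := cwal_tail b a L0 n x) in *. set (D := csum _ n) in hd, hfr.
    set (z := INR b ^ (a + n) * x - INR (floor_at b (a + n) x)) in *.
    replace T with (D * cwal b L0 x - RtoC ((1 - y) / 2) * cwal b L0 x)%C
      by (rewrite hd; ring).
    unfold cwal_primitive, cwal_sum. fold Q L0 p.
    replace D with (RtoC (p * x - INR (floor_at b a x)) - RtoC (y * z))%C
      by (rewrite hfr; ring).
    unfold rem. fold z.
    assert (e : (RtoC p * RtoC (/ p))%C = RtoC 1)
       by (rewrite <- RtoC_mult; f_equal; field; lra).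
    assert (e1 : (RtoC p * RtoC (x - INR (floor_at b a x) * / p))%C =
      RtoC (p * x - INR (floor_at b a x)))
       by (rewrite <- RtoC_mult; f_equal; field; lra).
    assert (e2 : RtoC (g x * (y * z - y / 2)) =
      (RtoC (g x) * (RtoC (y * z) + RtoC ((1 - y) / 2) - / 2))%C).
    { rewrite <- RtoC_inv, <- RtoC_plus, <- RtoC_minus, <- RtoC_mult by lra.
      f_equal. field. }
    rewrite e2.
    transitivity (RtoC (g x) * (RtoC p * RtoC (/ p)) * Q * (cwal b L x - cwal b L0 x)
      + RtoC (g x) * (RtoC p * RtoC (x - INR (floor_at b a x) * / p)) * cwal b L0 x
      - Q * (RtoC (g x) * cwal b L x) - (/ 2 - Q) * (RtoC (g x) * cwal b L0 x)
      - RtoC (g x) * ((RtoC (p * x - INR (floor_at b a x)) - RtoC (y * z)) * cwal b L0 x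
         - RtoC ((1 - y) / 2) * cwal b L0 x))%C; [ring|].
    rewrite e, e1. ring.
  + eapply is_RIntC_eq.
    * apply is_RIntC_plus; [apply is_RIntC_scal, hJ|].
      apply is_RIntC_plus; [apply is_RIntC_scal, hI0|].
      apply is_RIntC_plus; [apply is_RIntC_scal, hI1|].
      apply is_RIntC_plus; [apply is_RIntC_scal, hI2|].
      apply is_RIntC_scal, hI3.
    * ring.
Qed.

Lemma Rle_pow_limit (X Y M x : R) : 0 <= x < 1 ->
  (forall n, X <= Y + M * x ^ n) -> X <= Y.
Proof.
intros hx h.
assert (hl : is_lim_seq (fun n => Y + M * x ^ n) (Y + M * 0)).
{ apply (is_lim_seq_plus' (fun _ => Y)); [apply is_lim_seq_const|].
  apply (is_lim_seq_scal_l (fun n => x ^ n) M 0).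
  apply is_lim_seq_geom. rewrite Rabs_pos_eq; lra. }
rewrite Rmult_0_r, Rplus_0_r in hl.
exact (is_lim_seq_le (fun _ => X) _ X Y h (is_lim_seq_const X) hl).
Qed.

(** The rate [beta] measures how coefficients with one more leading digit decay as that digit moves
    away. With the weights [b^-c] this gives a geometric series of sum [beta / (b - beta)], and the
    [b - 1] possible values of the digit give the factor in front. Letting [n] grow in the identity
    removes the error. *)
Lemma cwal_coef_recursion (b a k : nat) (L : list (nat * nat)) (f g : R -> R)
  (B1 B2 B3 beta : R) :
  (2 <= b)%nat -> expansion b ((a, k) :: L) ->
  (forall x, is_derive f x (g x)) -> (forall x, continuous g x) ->
  Cmod (cwal_coef b L g) <= B1 -> Cmod (cwal_coef b ((a, k) :: L) g) <= B2 ->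
  0 <= B3 -> 0 < beta <= 1 ->
  (forall c t, (0 < c)%nat -> (0 < t < b)%nat ->
    Cmod (cwal_coef b ((a + c, t)%nat :: (a, k) :: L) g) <= B3 * beta ^ c) ->
  Cmod (cwal_coef b ((a, k) :: L) f) <=
  / INR b ^ a * / (2 * sin (PI / INR b)) *
  (B1 + middle_factor b * B2 + (INR b - 1) * B3 * (beta / (INR b - beta))).
Proof.
intros hb hL hf hg hB1 hB2 hB3 hbeta h.
destruct (cwal_coef_identity b a k L f g hb hL hf hg) as (M & hM & H).
assert (hb0 : 2 <= INR b) by (apply (le_INR 2); lia).
pose proof (sin_PI_div_pos b hb) as hs.
destruct hL as (_ & hk & _). simpl in hk.
set (q := / (2 * sin (PI / INR b))).
assert (hq : 0 < q) by (apply Rinv_0_lt_compat; lra).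
assert (hp : 0 < / INR b ^ a) by (apply Rinv_0_lt_compat, pow_lt; lra).
apply (Rle_pow_limit _ _ (/ INR b ^ a * M) (/ INR b)).
{ split; [left; apply Rinv_0_lt_compat; lra|].
  rewrite <- Rinv_1. apply Rinv_lt_contravar; lra. }
intros n. destruct (H n) as (r & hr & ->).
rewrite Cmod_mult, Cmod_opp, Cmod_R, Rabs_pos_eq by lra.
rewrite !Rmult_assoc, <- Rmult_plus_distr_l.
apply Rmult_le_compat_l; [lra|].
eapply Rle_trans; [apply Cmod_triangle|]. apply Rplus_le_compat; [|exact hr].
eapply Rle_trans; [apply Cmod_triangle|].
rewrite Rmult_plus_distr_l. apply Rplus_le_compat.
- eapply Rle_trans; [apply Cmod_triangle|].
  rewrite Rmult_plus_distr_l. apply Rplus_le_compat.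
  + rewrite Cmod_mult. apply Rmult_le_compat; try apply Cmod_ge_0; [|exact hB1].
    pose proof (Cmod_div_one_minus_zeta_pow b k 1 hk) as h1.
    unfold Cdiv in h1. rewrite Cmult_1_l, Cmod_1, Rmult_1_l in h1. exact h1.
  + rewrite Cmod_mult. rewrite <- Rmult_assoc, (Rmult_comm q).
    apply Rmult_le_compat; try apply Cmod_ge_0; [|exact hB2].
    apply middle_coef_bound, hk.
- replace (q * ((INR b - 1) * (B3 * (beta / (INR b - beta))))) with
    (((INR b - 1) * (q * B3)) * ((beta / INR b) / (1 - beta / INR b)))
    by (field; lra).
  apply csum_geometric_bound.
  + assert (0 <= q * B3) by (apply Rmult_le_pos; lra). nra.
  + split; [left; apply Rdiv_lt_0_compat; lra|].
    apply Rmult_lt_reg_r with (INR b); [lra|]. field_simplify; lra.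
  + intros c _.
    assert (hc : 0 <= (/ INR b) ^ S c)
      by (apply pow_le; left; apply Rinv_0_lt_compat; lra).
    rewrite Cmod_mult, Cmod_R, Rabs_pos_eq by exact hc.
    unfold Rdiv. rewrite Rpow_mult_distr.
    replace ((INR b - 1) * (q * B3) * (beta ^ S c * (/ INR b) ^ S c)) with
      ((/ INR b) ^ S c * (INR (b - 1) * (q * (B3 * beta ^ S c))))
      by (rewrite minus_INR by lia; simpl; ring).
    apply Rmult_le_compat_l; [exact hc|].
    apply csum_bound. intros t ht. rewrite Cmod_mult.
    apply Rmult_le_compat; try apply Cmod_ge_0;
      [apply digit_coef_bound, ht | apply h; lia].
Qed.

(** * Induction on the number of derivatives *)


(** A function with its successive derivatives on the whole line, so that no one-sided derivatives
    appear in the induction. *)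
Definition differentiable_chain (r : nat) (G : nat -> R -> R) : Prop :=
  (forall s, (s < r)%nat -> forall x, is_derive (G s) x (G (S s) x)) /\
  (forall x, continuous (G r) x).

Lemma differentiable_chain_tail (r : nat) (G : nat -> R -> R) :
  differentiable_chain (S r) G -> differentiable_chain r (fun s => G (S s)).
Proof.
intros [h1 h2]. split; [|exact h2]. intros s hs. apply h1. lia.
Qed.

Lemma differentiable_chain_continuous (r s : nat) (G : nat -> R -> R) :
  differentiable_chain r G -> (s <= r)%nat -> forall x, continuous (G s) x.
Proof.
intros [h1 h2] hs x. destruct (Nat.eq_dec s r) as [->|e]; [apply h2|].
apply (ex_derive_continuous (K := R_AbsRing) (V := R_NormedModule)).
eexists. apply h1. lia.
Qed.

Lemma variation_bound_nonneg (lambda : R) (g : R -> R) (V : R) :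
  variation_bound lambda g V -> 0 <= V.
Proof.
intros h.
assert (hp : is_partition01 1 INR).
{ repeat split. intros n hn. apply lt_INR. lia. }
eapply Rle_trans; [|exact (h _ _ hp)].
apply sum_n_m_nonneg. intros i.
unfold Rdiv. repeat apply Rmult_le_pos; try apply Rabs_pos.
left. apply Rinv_0_lt_compat, exp_pos.
Qed.

(* [weight lambda r L] is a_1 + ... + a_r + lambda a_(r+1), provided L has more than r
   entries. *)
Fixpoint weight (lambda : R) (r : nat) (L : list (nat * nat)) : R :=
  match r, L with
  | O, _ => lambda * INR (lead L)
  | S r, nil => 0
  | S r, p :: L => INR (fst p) + weight lambda r L
  end.

Lemma weight_firstn (lambda : R) (r : nat) (L : list (nat * nat)) : (r < length L)%nat ->
  weight lambda r L = INR (list_sum (firstn r (map fst L)))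
    + lambda * INR (nth r (map fst L) 0%nat).
Proof.
revert L. induction r as [|r IH]; intros [|p L] hl; try (simpl in hl; lia).
- cbn. ring.
- cbn [weight map firstn nth]. rewrite IH by (simpl in hl; lia).
  change (list_sum (fst p :: firstn r (map fst L))) with
    (fst p + list_sum (firstn r (map fst L)))%nat.
  rewrite plus_INR. ring.
Qed.

(** * Decay in powers of the base and the two inductions *)

Section Weights.

Variables (b : nat) (lambda : R).
Hypothesis hb : (2 <= b)%nat.
Hypothesis hlambda : 0 < lambda <= 1.

Definition bpow (x : R) : R := Rpower (INR b) (- x).

Lemma bpow_pos (x : R) : 0 < bpow x.
Proof. apply exp_pos. Qed.

Lemma bpow_plus (x y : R) : bpow (x + y) = bpow x * bpow y.
Proof. unfold bpow. rewrite Ropp_plus_distr. apply Rpower_plus. Qed.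

Lemma bpow_INR (n : nat) : bpow (INR n) = / INR b ^ n.
Proof.
unfold bpow. rewrite Rpower_Ropp, Rpower_pow; [reflexivity|].
apply lt_0_INR. lia.
Qed.

Lemma bpow_mult_INR (x : R) (n : nat) : bpow (x * INR n) = bpow x ^ n.
Proof.
unfold bpow. rewrite <- Rpower_pow by apply exp_pos.
rewrite Rpower_mult. f_equal. ring.
Qed.

Lemma bpow_le (x y : R) : x <= y -> bpow y <= bpow x.
Proof.
intros h. assert (2 <= INR b) by (apply (le_INR 2), hb).
apply Rle_Rpower; lra.
Qed.

Lemma bpow_le_1 (x : R) : 0 <= x -> bpow x <= 1.
Proof.
intros h. apply bpow_le in h. unfold bpow at 2 in h.
rewrite Ropp_0, Rpower_O in h; [exact h|]. apply lt_0_INR. lia.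
Qed.

Lemma Rpower_inv_pow (a : nat) : Rpower (/ INR b ^ a) lambda = bpow (lambda * INR a).
Proof.
rewrite <- bpow_INR. unfold bpow. rewrite Rpower_mult. f_equal. ring.
Qed.

(** With [c_1 > c_2 > ...] the positions of [L], the weights differ by
    [a - c_(r+1) + lambda (c_(r+1) - c_(r+2))], which is at least [a - c_1]. Prepending a digit thus
    gains at least a factor [b^-(a - c_1)]. *)
Lemma weight_gap (r a k : nat) (L : list (nat * nat)) :
  expansion b ((a, k) :: L) -> (S r < length L)%nat ->
  weight lambda (S r) L + INR (a - lead L) <= weight lambda (S r) ((a, k) :: L).
Proof.
revert a k L. induction r as [|r IH]; intros a k L (h1 & _ & h3) hl; simpl in h1;
  (destruct L as [|[a' k'] L]; [simpl in hl; lia|]);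
  (destruct L as [|[a'' k''] L]; [simpl in hl; lia|]);
  cbn [lead fst] in *; rewrite minus_INR by lia.
- destruct h3 as (h4 & _). simpl in h4.
  assert (INR a'' <= INR a') by (apply le_INR; lia).
  cbn [weight lead fst]. nra.
- specialize (IH a' k' ((a'', k'') :: L) h3 ltac:(simpl in *; lia)).
  cbn [lead fst] in IH. cbn [weight fst] in *.
  pose proof (pos_INR (a' - a'')). lra.
Qed.

Lemma weight_total_gap (a k : nat) (L : list (nat * nat)) :
  expansion b ((a, k) :: L) -> L <> nil ->
  1 + (INR (list_sum (map fst L)) + lambda * INR (nth (length L - 1) (map fst L) 0%nat))
  <= weight lambda (length L) ((a, k) :: L).
Proof.
revert a k. induction L as [|[a' k'] L IH]; intros a k (h1 & _ & h3) hn;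
  [congruence|]. simpl in h1.
assert (h4 : INR a' + 1 <= INR a) by (rewrite <- S_INR; apply le_INR; lia).
destruct L as [|p L].
- cbn. rewrite Nat.add_0_r. lra.
- specialize (IH a' k' h3 ltac:(congruence)).
  change (list_sum (map fst ((a', k') :: p :: L))) with
    (a' + list_sum (map fst (p :: L)))%nat.
  rewrite plus_INR.
  replace (nth (length ((a', k') :: p :: L) - 1) (map fst ((a', k') :: p :: L)) 0%nat)
    with (nth (length (p :: L) - 1) (map fst (p :: L)) 0%nat)
    by (simpl; rewrite Nat.sub_0_r; reflexivity).
  change (weight lambda (length ((a', k') :: p :: L)) ((a, k) :: (a', k') :: p :: L)) with
    (INR a + weight lambda (length (p :: L)) ((a', k') :: p :: L)).
  lra.
Qed.

Let q : R := / (2 * sin (PI / INR b)).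
Let P : R := 1 + 1 / INR b + 1 / (INR b * (INR b + 1)).
Let K : R := INR (b / 2).
Let m : R := middle_factor b.

(** The summands 1, [m b^-lambda] and [b^-lambda] belong to the three terms of one recursion step
    started from the variation bound. *)
Definition many_digits_constant : R := K * (1 + (1 + m) * bpow lambda).

Lemma base_ge_2 : 2 <= INR b.
Proof. apply (le_INR 2), hb. Qed.

Lemma middle_factor_bounds : 0 <= m <= 1.
Proof. unfold m, middle_factor. destruct (b =? 2)%nat; lra. Qed.

Lemma sin_factor_pos : 0 < q.
Proof.
pose proof (sin_PI_div_pos b hb). apply Rinv_0_lt_compat. lra.
Qed.

Lemma growth_pos : 0 < P.
Proof.
pose proof base_ge_2.
assert (0 < 1 / INR b) by (apply Rdiv_lt_0_compat; lra).
assert (0 < 1 / (INR b * (INR b + 1))) by (apply Rdiv_lt_0_compat; nra).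
unfold P. lra.
Qed.

(** The three terms of the recursion, relative to [B1], contribute at most 1, [1/b] and [((b - 1)/b)
    (1/b)/(b - 1/b) = 1/(b (b + 1))]. Their sum is the growth factor [P]. *)
Lemma growth_step (B1 B2 : R) (a : nat) : 0 <= B1 -> B2 <= B1 * / INR b ->
  0 <= B2 ->
  / INR b ^ a * q * (B1 + m * B2 + (INR b - 1) * (B1 * / INR b) *
    (/ INR b / (INR b - / INR b))) <= bpow (INR a) * (q * P) * B1.
Proof.
intros h1 h2 h3. pose proof base_ge_2 as h4. pose proof middle_factor_bounds.
pose proof sin_factor_pos.
rewrite bpow_INR. rewrite !Rmult_assoc.
assert (0 < / INR b ^ a) by (apply Rinv_0_lt_compat, pow_lt; lra).
do 2 (apply Rmult_le_compat_l; [lra|]).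
replace (P * B1) with (B1 + B1 * / INR b + B1 * (1 / (INR b * (INR b + 1))))
  by (unfold P; field; lra).
replace ((INR b - 1) * (B1 * (/ INR b * (/ INR b / (INR b - / INR b))))) with
  (B1 * (1 / (INR b * (INR b + 1)))) by (field; nra).
assert (m * B2 <= 1 * B2) by (apply Rmult_le_compat_r; lra). lra.
Qed.

(** Every list in the recursion for [G 0] keeps enough digits for the bound on [G 1]: the variation
    bound at the start, the induction hypothesis later. From then on [weight_gap] gives the ratio
    [1/b] that [growth_step] expects. *)
Lemma cwal_coef_many_digits (r : nat) (G : nat -> R -> R) (V : R)
  (L : list (nat * nat)) :
  differentiable_chain (S r) G -> variation_bound lambda (G (S r)) V ->
  expansion b L -> (S r < length L)%nat ->
  Cmod (cwal_coef b L (G O)) <=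
  q * (q * P) ^ r * (many_digits_constant * V) * bpow (weight lambda (S r) L).
Proof.
pose proof base_ge_2 as hb0. pose proof middle_factor_bounds as hm.
pose proof sin_factor_pos as hq. pose proof growth_pos as hP.
revert G L. induction r as [|r IH]; intros G L hG hV hL hl;
  pose proof (variation_bound_nonneg _ _ _ hV) as hV0;
  (destruct L as [|[a k] L]; [simpl in hl; lia|]);
  pose proof (pos_INR (b / 2)) as hK; fold K in hK;
  (assert (hL' := hL); destruct hL' as (h1 & h2 & h3); simpl in h1);
  pose proof (bpow_pos lambda) as hbl.
- destruct L as [|[a' k'] L]; [simpl in hl; lia|]. simpl in h1.
  assert (h4 : INR a' + 1 <= INR a) by (rewrite <- S_INR; apply le_INR; lia).
  assert (hg := differentiable_chain_continuous 1 1 G hG (Nat.le_refl 1)).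
  set (B := K * V).
  assert (hB : 0 <= B) by (apply Rmult_le_pos; assumption).
  assert (hbound : forall a k L, expansion b ((a, k) :: L) ->
    Cmod (cwal_coef b ((a, k) :: L) (G 1%nat)) <= B * bpow (lambda * INR a)).
  { intros. rewrite <- Rpower_inv_pow.
    apply cwal_coef_variation_bound; assumption. }
  eapply Rle_trans.
  + apply (cwal_coef_recursion b a k _ (G 0%nat) (G 1%nat)
      (B * bpow (lambda * INR a')) (B * bpow (lambda * INR a))
      (B * bpow (lambda * INR a)) (bpow lambda) hb hL).
    * apply (proj1 hG). lia.
    * exact hg.
    * apply hbound, h3.
    * apply hbound, hL.
    * apply Rmult_le_pos; [exact hB | left; apply bpow_pos].
    * split; [exact hbl | apply bpow_le_1; lra].
    * intros c t hc ht. eapply Rle_trans.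
      { apply hbound. split; [simpl; lia | split; [exact ht | exact hL]]. }
      right. rewrite plus_INR, Rmult_plus_distr_l, bpow_plus, Rmult_assoc.
      rewrite (bpow_mult_INR lambda c). reflexivity.
  + fold q m. cbn [weight fst lead]. rewrite bpow_plus, bpow_INR.
    assert (hp : 0 < / INR b ^ a) by (apply Rinv_0_lt_compat, pow_lt; lra).
    set (y := bpow (lambda * INR a')).
    assert (hy : 0 < y) by apply bpow_pos.
    (* As [a >= a' + 1], the coefficient of the full list is smaller by a factor [b^-lambda]. *)
    assert (hya : bpow (lambda * INR a) <= y * bpow lambda).
    { unfold y. rewrite <- bpow_plus. apply bpow_le. nra. }
    pose proof (bpow_pos (lambda * INR a)) as hya0.
    set (w := bpow (lambda * INR a)) in *.
    (* The series over further leading digits costs no more than one coefficient, because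
       [b^-lambda <= 1]. *)
    assert (hfrac : (INR b - 1) * (bpow lambda / (INR b - bpow lambda)) <= 1).
    { pose proof (bpow_le_1 lambda ltac:(lra)).
      apply Rmult_le_reg_r with (INR b - bpow lambda); [lra|].
      field_simplify; nra. }
    rewrite pow_O, Rmult_1_r. unfold many_digits_constant. fold K m.
    replace (q * (K * (1 + (1 + m) * bpow lambda) * V) * (/ INR b ^ a * y)) with
      (/ INR b ^ a * q * (B * (y + m * (y * bpow lambda) + y * bpow lambda)))
      by (unfold B; ring).
    apply Rmult_le_compat_l; [apply Rmult_le_pos; lra|].
    replace (B * y + m * (B * w) + (INR b - 1) * (B * w) *
      (bpow lambda / (INR b - bpow lambda))) with
      (B * (y + m * w + w * ((INR b - 1) * (bpow lambda / (INR b - bpow lambda)))))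
      by (unfold Rdiv; ring).
    apply Rmult_le_compat_l; [exact hB|].
    assert (w * ((INR b - 1) * (bpow lambda / (INR b - bpow lambda))) <= w * 1)
      by (apply Rmult_le_compat_l; lra).
    assert (m * w <= m * (y * bpow lambda)) by (apply Rmult_le_compat_l; lra).
    lra.
- assert (hg := differentiable_chain_continuous _ 1 G hG ltac:(lia)).
  assert (hD : 0 <= many_digits_constant).
  { apply Rmult_le_pos; [exact hK|]. nra. }
  set (A := q * (q * P) ^ r * (many_digits_constant * V)).
  assert (hA : 0 <= A).
  { apply Rmult_le_pos; [|apply Rmult_le_pos; assumption].
    apply Rmult_le_pos; [lra|]. apply pow_le, Rmult_le_pos; lra. }
  assert (hbound : forall L, expansion b L -> (S r < length L)%nat ->
    Cmod (cwal_coef b L (G 1%nat)) <= A * bpow (weight lambda (S r) L)).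
  { intros L0 h5 h6. apply (IH (fun s => G (S s)) L0);
      [apply differentiable_chain_tail, hG | exact hV | exact h5 | exact h6]. }
  simpl in hl.
  pose proof (weight_gap r a k L hL ltac:(lia)) as hgap.
  assert (h4 : 1 <= INR (a - lead L)) by (apply (le_INR 1); lia).
  set (y := bpow (weight lambda (S r) L)).
  assert (hy : 0 < y) by apply bpow_pos.
  assert (hyL : bpow (weight lambda (S r) ((a, k) :: L)) <= y * / INR b).
  { unfold y. rewrite <- (pow_1 (INR b)), <- bpow_INR, <- bpow_plus.
    apply bpow_le. simpl INR. lra. }
  eapply Rle_trans.
  + apply (cwal_coef_recursion b a k _ (G 0%nat) (G 1%nat)
      (A * y) (A * bpow (weight lambda (S r) ((a, k) :: L))) (A * y * / INR b)
      (/ INR b) hb hL).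
    * apply (proj1 hG). lia.
    * exact hg.
    * apply hbound; [exact h3 | lia].
    * apply hbound; [exact hL | simpl; lia].
    * apply Rmult_le_pos; [apply Rmult_le_pos; lra|].
      left. apply Rinv_0_lt_compat. lra.
    * split; [apply Rinv_0_lt_compat; lra|].
      rewrite <- Rinv_1. apply Rinv_le_contravar; lra.
    * intros c t hc ht.
      assert (hE : expansion b ((a + c, t)%nat :: (a, k) :: L))
        by (split; [simpl; lia | split; [exact ht | exact hL]]).
      eapply Rle_trans; [apply hbound; [exact hE | simpl; lia]|].
      rewrite !Rmult_assoc. apply Rmult_le_compat_l; [exact hA|].
      pose proof (weight_gap r (a + c) t _ hE ltac:(simpl; lia)) as hg2.
      cbn [lead fst] in hg2. replace (a + c - a)%nat with c in hg2 by lia.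
      apply Rle_trans with (bpow (weight lambda (S r) ((a, k) :: L)) * (/ INR b) ^ c).
      { rewrite pow_inv, <- bpow_INR, <- bpow_plus. apply bpow_le. exact hg2. }
      rewrite <- Rmult_assoc. apply Rmult_le_compat_r; [|exact hyL].
      apply pow_le. left. apply Rinv_0_lt_compat. lra.
  + change (weight lambda (S (S r)) ((a, k) :: L)) with (INR a + weight lambda (S r) L).
    rewrite bpow_plus. fold y.
    replace (q * (q * P) ^ S r * (many_digits_constant * V) * (bpow (INR a) * y))
      with (bpow (INR a) * (q * P) * (A * y)) by (unfold A; simpl; ring).
    apply growth_step.
    * apply Rmult_le_pos; lra.
    * rewrite Rmult_assoc. apply Rmult_le_compat_l; assumption.
    * apply Rmult_le_pos; [lra | left; apply bpow_pos].
Qed.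

(* The middle coefficient of the recursion vanishes for b = 2; this is what
   keeps the constant of the variation term at 2 K' in the induction. *)
Lemma cwal_coef_exact_digits (r : nat) (G : nat -> R -> R) (V K' : R)
  (L : list (nat * nat)) :
  K * (2 + m) <= 2 * K' ->
  differentiable_chain (S r) G -> variation_bound lambda (G (S r)) V ->
  expansion b L -> length L = S r ->
  Cmod (cwal_coef b L (G O)) <=
  q * (q * P) ^ r * bpow (INR (list_sum (map fst L))) *
  (Rabs (RInt (G (S r)) 0 1)
   + 2 * K' * bpow (lambda * INR (nth r (map fst L) 0%nat)) * V).
Proof.
intros hK'.
pose proof base_ge_2 as hb0. pose proof middle_factor_bounds as hm.
pose proof sin_factor_pos as hq. pose proof growth_pos as hP.
pose proof (bpow_pos lambda) as hbl.
pose proof (bpow_le_1 lambda ltac:(lra)) as hbl1.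
pose proof (pos_INR (b / 2)) as hK; fold K in hK.
assert (hK'0 : 0 <= K') by nra.
revert G L. induction r as [|r IH]; intros G L hG hV hL hl;
  pose proof (variation_bound_nonneg _ _ _ hV) as hV0;
  (destruct L as [|[a k] L]; [simpl in hl; lia|]);
  (assert (hL' := hL); destruct hL' as (h1 & h2 & h3); simpl in h1).
- destruct L as [|p L]; [|simpl in hl; lia].
  assert (hg := differentiable_chain_continuous 1 1 G hG (Nat.le_refl 1)).
  set (B := K * V).
  assert (hB : 0 <= B) by (apply Rmult_le_pos; assumption).
  assert (hbound : forall a k L, expansion b ((a, k) :: L) ->
    Cmod (cwal_coef b ((a, k) :: L) (G 1%nat)) <= B * bpow (lambda * INR a)).
  { intros. rewrite <- Rpower_inv_pow.
    apply cwal_coef_variation_bound; assumption. }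
  eapply Rle_trans.
  (* With [beta = 1] the tail factor [(b - 1) beta / (b - beta)] equals 1. *)
  + apply (cwal_coef_recursion b a k _ (G 0%nat) (G 1%nat)
      (Rabs (RInt (G 1%nat) 0 1)) (B * bpow (lambda * INR a))
      (B * bpow (lambda * INR a)) 1 hb hL).
    * apply (proj1 hG). lia.
    * exact hg.
    (* Removing the only digit leaves the constant Walsh function; this is where the integral of the
       last derivative enters. *)
    * rewrite cwal_coef_nil, Cmod_R by exact hg. apply Rle_refl.
    * apply hbound, hL.
    * apply Rmult_le_pos; [exact hB | left; apply bpow_pos].
    * lra.
    * intros c t hc ht. eapply Rle_trans.
      { apply hbound. split; [simpl; lia | split; [exact ht | exact hL]]. }
      rewrite pow1, Rmult_1_r. apply Rmult_le_compat_l; [exact hB|].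
      apply bpow_le, Rmult_le_compat_l; [lra|]. apply le_INR. lia.
  + fold q m. cbn [map fst nth list_sum fold_right]. rewrite Nat.add_0_r.
    rewrite pow_O, Rmult_1_r, bpow_INR.
    rewrite (Rmult_comm q). apply Rmult_le_compat_l.
    { apply Rmult_le_pos; [left; apply Rinv_0_lt_compat, pow_lt; lra | lra]. }
    set (w := bpow (lambda * INR a)).
    assert (hw : 0 < w) by apply bpow_pos.
    replace ((INR b - 1) * (B * w) * (1 / (INR b - 1))) with (B * w) by (field; lra).
    rewrite Rplus_assoc. apply Rplus_le_compat_l.
    replace (m * (B * w) + B * w) with ((K * (1 + m)) * w * V) by (unfold B; ring).
    do 2 (apply Rmult_le_compat_r; [lra|]). nra.
- assert (hg := differentiable_chain_continuous _ 1 G hG ltac:(lia)).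
  simpl in hl.
  assert (hD : many_digits_constant <= 2 * K').
  { unfold many_digits_constant. fold K m.
    assert (K * ((1 + m) * bpow lambda) <= K * ((1 + m) * 1)) by
      (apply Rmult_le_compat_l; [exact hK | apply Rmult_le_compat_l; lra]). lra. }
  assert (hD0 : 0 <= many_digits_constant).
  { apply Rmult_le_pos; [exact hK|]. nra. }
  set (Z := Rabs (RInt (G (S (S r))) 0 1)).
  assert (hZ : 0 <= Z) by apply Rabs_pos.
  set (s := bpow (INR (list_sum (map fst L)))).
  set (w := bpow (lambda * INR (nth r (map fst L) 0%nat))).
  assert (hs : 0 < s) by apply bpow_pos. assert (hw : 0 < w) by apply bpow_pos.
  set (A := q * (q * P) ^ r).
  assert (hA : 0 <= A).
  { unfold A. apply Rmult_le_pos; [lra|]. apply pow_le, Rmult_le_pos; lra. }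
  set (B := A * s * (Z + 2 * K' * w * V)).
  assert (hX : 0 <= 2 * K' * w * V) by (repeat apply Rmult_le_pos; lra).
  assert (hAs : 0 <= A * s) by (apply Rmult_le_pos; lra).
  assert (hB : 0 <= B) by (apply Rmult_le_pos; lra).
  (* Only the tail [L] has exactly [S r] digits and falls under the induction hypothesis. The full
     list and its prolongations have more, and are covered by the many-digit bound. *)
  assert (hbound : forall L, expansion b L -> (S r < length L)%nat ->
    Cmod (cwal_coef b L (G 1%nat)) <=
      A * (many_digits_constant * V) * bpow (weight lambda (S r) L)).
  { intros L0 h5 h6. apply (cwal_coef_many_digits r (fun s => G (S s)) V L0);
      [apply differentiable_chain_tail, hG | exact hV | exact h5 | exact h6]. }
  assert (hdv : 0 <= A * (many_digits_constant * V))
    by (apply Rmult_le_pos; [exact hA | apply Rmult_le_pos; assumption]).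
  set (y := bpow (weight lambda (S r) ((a, k) :: L))).
  assert (hy0 : 0 < y) by apply bpow_pos.
  assert (hyL : y <= s * w * / INR b).
  { pose proof (weight_total_gap a k L hL) as ht.
    replace (length L) with (S r) in ht by lia.
    replace (S r - 1)%nat with r in ht by lia.
    unfold y, s, w. rewrite <- (pow_1 (INR b)), <- bpow_INR, <- !bpow_plus.
    apply bpow_le. simpl INR.
    assert (hn : L <> nil) by (intros ->; simpl in hl; lia).
    specialize (ht hn). lra. }
  (* The many-digit bound fits into the variation part of [B], thanks to
     [many_digits_constant <= 2 K'] and the factor [1/b] from [weight_total_gap]. *)
  assert (hB2 : A * (many_digits_constant * V) * y <= B * / INR b).
  { apply Rle_trans with (A * (2 * K' * V) * (s * w * / INR b)).
    - apply Rmult_le_compat; try lra.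
      apply Rmult_le_compat_l; [exact hA|].
      apply Rmult_le_compat_r; assumption.
    - replace (A * (2 * K' * V) * (s * w * / INR b)) with
        (A * s * (2 * K' * w * V) * / INR b) by ring.
      apply Rmult_le_compat_r; [left; apply Rinv_0_lt_compat; lra|].
      apply Rmult_le_compat_l; lra. }
  eapply Rle_trans.
  + apply (cwal_coef_recursion b a k _ (G 0%nat) (G 1%nat)
      B (A * (many_digits_constant * V) * y) (B * / INR b)
      (/ INR b) hb hL).
    * apply (proj1 hG). lia.
    * exact hg.
    * apply (IH (fun s => G (S s)) L);
      [apply differentiable_chain_tail, hG | exact hV | exact h3 | lia].
    * apply hbound; [exact hL | simpl; lia].
    * apply Rmult_le_pos; [exact hB|]. left. apply Rinv_0_lt_compat. lra.
    * split; [apply Rinv_0_lt_compat; lra|].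
      rewrite <- Rinv_1. apply Rinv_le_contravar; lra.
    * intros c t hc ht.
      assert (hE : expansion b ((a + c, t)%nat :: (a, k) :: L))
        by (split; [simpl; lia | split; [exact ht | exact hL]]).
      eapply Rle_trans; [apply hbound; [exact hE | simpl; lia]|].
      pose proof (weight_gap r (a + c) t _ hE ltac:(simpl; lia)) as hg2.
      cbn [lead fst] in hg2. replace (a + c - a)%nat with c in hg2 by lia.
      apply Rle_trans with (A * (many_digits_constant * V) * y * (/ INR b) ^ c).
      { rewrite (Rmult_assoc _ y). apply Rmult_le_compat_l; [exact hdv|].
        unfold y. rewrite pow_inv, <- bpow_INR, <- bpow_plus.
        apply bpow_le. exact hg2. }
      apply Rmult_le_compat_r; [|exact hB2].
      apply pow_le. left. apply Rinv_0_lt_compat. lra.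
  + change (list_sum (map fst ((a, k) :: L))) with (a + list_sum (map fst L))%nat.
    change (nth (S r) (map fst ((a, k) :: L)) 0%nat) with (nth r (map fst L) 0%nat).
    rewrite plus_INR, bpow_plus. fold s w Z.
    replace (q * (q * P) ^ S r * (bpow (INR a) * s) * (Z + 2 * K' * w * V))
      with (bpow (INR a) * (q * P) * B) by (unfold B, A; simpl; ring).
    apply growth_step; [exact hB | exact hB2 |].
    apply Rmult_le_pos; lra.
Qed.

End Weights.

(** * One-sided derivatives and the Walsh coefficients *)


(** The nearest point of [[0,1]]; composing with it extends a function continuous on the interval to
    one continuous on the line. *)
Definition clamp01 (x : R) : R := Rmax 0 (Rmin 1 x).

Lemma clamp01_I01 (x : R) : I01 (clamp01 x).
Proof.
unfold I01, clamp01, Rmax, Rmin.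
destruct (Rle_dec 1 x); destruct (Rle_dec 0 _); lra.
Qed.

Lemma clamp01_id (x : R) : I01 x -> clamp01 x = x.
Proof.
unfold I01, clamp01, Rmax, Rmin. intros h.
destruct (Rle_dec 1 x); destruct (Rle_dec 0 _); lra.
Qed.

Lemma clamp01_lipschitz (x y : R) : Rabs (clamp01 y - clamp01 x) <= Rabs (y - x).
Proof.
unfold clamp01, Rmax, Rmin.
destruct (Rle_dec 1 x); destruct (Rle_dec 1 y); repeat destruct (Rle_dec 0 _);
  unfold Rabs; repeat destruct (Rcase_abs _); lra.
Qed.

Lemma continuous_clamp01 (f : R -> R) : continuous_on I01 f ->
  forall x, continuous (fun y => f (clamp01 y)) x.
Proof.
intros hf x. specialize (hf _ (clamp01_I01 x)).
eapply filterlim_comp; [|exact hf].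
intros P [d hd]. exists d. intros y hy. apply hd; [|apply clamp01_I01].
eapply Rle_lt_trans; [apply clamp01_lipschitz | exact hy].
Qed.

Lemma is_deriv01_eps (f : R -> R) (x l : R) : is_deriv01 f x l ->
  forall eps, 0 < eps -> exists d, 0 < d /\ forall y, Rabs (y - x) < d ->
    I01 y -> y <> x -> Rabs ((f y - f x) / (y - x) - l) < eps.
Proof.
intros h eps he.
destruct (proj1 (filterlim_locally _ _) h (mkposreal eps he)) as [d hd].
exists d. split; [apply cond_pos|]. intros y hy h1 h2.
exact (hd y hy (conj h1 h2)).
Qed.

Lemma is_deriv01_continuous (f : R -> R) (x l : R) : is_deriv01 f x l ->
  filterlim f (within I01 (locally x)) (locally (f x)).
Proof.
intros h. apply filterlim_locally. intros eps.
destruct (is_deriv01_eps f x l h 1 Rlt_0_1) as (d & hd & H).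
pose proof (Rabs_pos l) as hl. pose proof (cond_pos eps) as he.
(* Within distance [d] all slopes are bounded by [|l| + 1]. *)
assert (hm : 0 < Rmin d (eps / (Rabs l + 1))).
{ apply Rmin_glb_lt; [assumption|]. apply Rdiv_lt_0_compat; lra. }
exists (mkposreal _ hm). intros y hy hI.
change (Rabs (f y - f x) < eps). change (Rabs (y - x) < Rmin d (eps / (Rabs l + 1))) in hy.
destruct (Req_dec y x) as [->|hn].
- rewrite Rminus_diag, Rabs_R0. exact he.
- pose proof (Rmin_l d (eps / (Rabs l + 1))) as h1.
  pose proof (Rmin_r d (eps / (Rabs l + 1))) as h2.
  specialize (H y ltac:(lra) hI hn).
  set (t := (f y - f x) / (y - x)) in *.
  replace (f y - f x) with (t * (y - x)) by (unfold t; field; lra).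
  rewrite Rabs_mult.
  assert (ht : Rabs t <= Rabs l + 1).
  { replace t with (l + (t - l)) by ring.
    eapply Rle_trans; [apply Rabs_triang|]. lra. }
  apply Rle_lt_trans with ((Rabs l + 1) * Rabs (y - x)).
  + apply Rmult_le_compat_r; [apply Rabs_pos | exact ht].
  + replace (pos eps) with ((Rabs l + 1) * (eps / (Rabs l + 1))) by (field; lra).
    apply Rmult_lt_compat_l; lra.
Qed.

Lemma is_deriv01_interior (f : R -> R) (x l : R) : 0 < x < 1 ->
  is_deriv01 f x l -> is_derive (fun y => f (clamp01 y)) x l.
Proof.
intros hx h. apply is_derive_Reals. intros eps he.
destruct (is_deriv01_eps f x l h eps he) as (d & hd & H).
assert (hm : 0 < Rmin d (Rmin x (1 - x))) by (repeat apply Rmin_glb_lt; lra).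
exists (mkposreal _ hm). intros t ht hlt. simpl in hlt.
pose proof (Rmin_l d (Rmin x (1 - x))). pose proof (Rmin_r d (Rmin x (1 - x))).
pose proof (Rmin_l x (1 - x)). pose proof (Rmin_r x (1 - x)).
assert (hI : I01 (x + t)).
{ destruct (Rabs_def2 t (Rmin x (1 - x))) as [h1 h2]; [lra|]. unfold I01. lra. }
rewrite !clamp01_id by (assumption || unfold I01; lra).
replace t with (x + t - x) at 2 by ring.
apply H; [|exact hI | lra].
replace (x + t - x) with t by ring. lra.
Qed.

Lemma is_deriv01_unique (f : R -> R) (x l l' : R) : I01 x ->
  is_deriv01 f x l -> is_deriv01 f x l' -> l = l'.
Proof.
intros hx h h'. apply Rminus_diag_uniq, Rabs_eq_0.
apply Rle_antisym; [|apply Rabs_pos].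
apply Rle_plus_epsilon. intros eps he.
destruct (is_deriv01_eps f x l h (eps / 2) ltac:(lra)) as (d & hd & H).
destruct (is_deriv01_eps f x l' h' (eps / 2) ltac:(lra)) as (d' & hd' & H').
(* The cap [1/2] ensures that a step of [t / 2], taken away from the nearer end point, stays in
   [[0,1]]. *)
set (t := Rmin (Rmin d d') (1 / 2)).
assert (ht : 0 < t) by (repeat apply Rmin_glb_lt; lra).
pose proof (Rmin_l (Rmin d d') (1 / 2)) as m1.
pose proof (Rmin_r (Rmin d d') (1 / 2)) as m2. fold t in m1, m2.
pose proof (Rmin_l d d'). pose proof (Rmin_r d d').
assert (exists y, I01 y /\ y <> x /\ Rabs (y - x) <= t / 2) as (y & hy & hn & hd2).
{ unfold I01 in *. destruct (Rle_dec x (1 / 2)).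
  - exists (x + t / 2). repeat split; try lra.
    replace (x + t / 2 - x) with (t / 2) by ring. rewrite Rabs_pos_eq; lra.
  - exists (x - t / 2). repeat split; try lra.
    replace (x - t / 2 - x) with (- (t / 2)) by ring.
    rewrite Rabs_Ropp, Rabs_pos_eq; lra. }
specialize (H y ltac:(lra) hy hn). specialize (H' y ltac:(lra) hy hn).
replace (l - l') with (((f y - f x) / (y - x) - l') - ((f y - f x) / (y - x) - l)) by ring.
eapply Rle_trans; [apply Rabs_triang|]. rewrite Rabs_Ropp. lra.
Qed.

Lemma deriv01_correct (f : R -> R) (x : R) : I01 x ->
  (exists l, is_deriv01 f x l) -> is_deriv01 f x (deriv01 f x).
Proof.
intros hx [l hl]. unfold deriv01.
apply (iota_correct (V := R_CompleteNormedModule) (is_deriv01 f x)).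
exists l. split; [exact hl|]. intros l' hl'.
exact (is_deriv01_unique f x l l' hx hl hl').
Qed.

(** Only the highest function is extended by clamping. Each lower one is recovered as the integral
    of its extended derivative, starting from its value at 0, and agrees with the original on
    [[0,1]] by the mean value theorem. *)
Lemma differentiable_chain_extension (r : nat) (F : nat -> R -> R) :
  (forall s x, (s < r)%nat -> I01 x -> is_deriv01 (F s) x (F (S s) x)) ->
  continuous_on I01 (F r) ->
  exists G, differentiable_chain r G /\
    forall s x, (s <= r)%nat -> I01 x -> G s x = F s x.
Proof.
revert F. induction r as [|r IH]; intros F hF hc.
- exists (fun s x => F s (clamp01 x)). split.
  + split; [intros; lia | apply continuous_clamp01, hc].
  + intros s x _ hx. rewrite clamp01_id by exact hx. reflexivity.
- destruct (IH (fun s => F (S s))) as (G & hG & hGF).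
  { intros s x hs. apply hF. lia. }
  { exact hc. }
  pose proof (differentiable_chain_continuous r 0 G hG ltac:(lia)) as hG0.
  set (G0 := fun x => F 0%nat 0 + RInt (G 0%nat) 0 x).
  assert (hd : forall x, is_derive G0 x (G 0%nat x)).
  { intros x. unfold G0.
    replace (G 0%nat x) with (plus 0 (G 0%nat x)) by (unfold plus; simpl; ring).
    apply (is_derive_plus (fun _ => F 0%nat 0)); [apply @is_derive_const|].
    apply (is_derive_RInt (V := R_NormedModule) (G 0%nat) _ 0); [|apply hG0].
    apply filter_forall. intros y.
    apply (RInt_correct (V := R_CompleteNormedModule)).
    apply (ex_RInt_continuous (V := R_CompleteNormedModule)). auto. }
  exists (fun s => match s with O => G0 | S s => G s end). split.
  + destruct hG as [h1 h2]. split; [|exact h2].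
    intros [|s] hs x; [apply hd | apply h1; lia].
  + intros [|s] x hs hx; [|apply hGF; [lia | exact hx]].
    assert (hF0 : continuous_on I01 (F 0%nat)).
    { intros y hy. eapply is_deriv01_continuous, hF; [lia | exact hy]. }
    unfold I01 in hx.
    (* The difference has zero derivative inside the interval and vanishes at 0. Clamping makes it
       continuous at the end points as a function on the line. *)
    destruct (MVT_gen (fun y => F 0%nat (clamp01 y) - G0 y) 0 x (fun _ => 0))
      as (c & _ & e).
    * rewrite Rmin_left, Rmax_right by lra. intros y hy.
      assert (hy01 : I01 y) by (unfold I01; lra).
      pose proof (is_deriv01_interior (F 0%nat) y (F 1%nat y)
        ltac:(lra) (hF 0%nat y ltac:(lia) hy01)) as h1.
      rewrite <- (hGF 0%nat y ltac:(lia) hy01) in h1.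
      assert (h2 : minus (G 0%nat y) (G 0%nat y) = 0) by exact (Rplus_opp_r _).
      cbn beta. rewrite <- h2.
      exact (is_derive_minus _ _ _ _ _ h1 (hd y)).
    * intros y _. apply continuity_pt_filterlim.
      apply (continuous_minus (V := R_NormedModule)
        (fun y => F 0%nat (clamp01 y)) G0).
      { apply continuous_clamp01, hF0. }
      { apply (ex_derive_continuous (K := R_AbsRing) (V := R_NormedModule)).
        eexists. apply hd. }
    * rewrite !clamp01_id in e by (unfold I01; lra).
      unfold G0 at 2 in e. rewrite RInt_point in e.
      unfold zero in e; simpl in e. lra.
Qed.

Lemma C01_extension (r : nat) (f : R -> R) : C01 r f ->
  exists G, differentiable_chain r G /\
    forall s x, (s <= r)%nat -> I01 x -> G s x = deriv01_n f s x.
Proof.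
intros [h1 h2]. apply differentiable_chain_extension; [|exact h2].
intros s x hs hx. apply deriv01_correct; [exact hx | apply h1; assumption].
Qed.

Lemma C01_le (s r : nat) (f : R -> R) : (s <= r)%nat -> C01 r f -> C01 s f.
Proof.
intros hs [h1 h2]. split.
- intros i x hi. apply h1. lia.
- destruct (Nat.eq_dec s r) as [->|e]; [exact h2|].
  intros x hx. destruct (h1 s x ltac:(lia) hx) as [l hl].
  exact (is_deriv01_continuous _ _ _ hl).
Qed.

Lemma partition01_I01 (N n : nat) (x : nat -> R) :
  is_partition01 N x -> (n <= N)%nat -> I01 (x n).
Proof.
intros (h0 & h1 & h) hn.
assert (hle : forall i j, (i <= j <= N)%nat -> x i <= x j).
{ intros i j. induction j as [|j IH]; intros hij.
  - replace i with 0%nat by lia. lra.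
  - destruct (Nat.eq_dec i (S j)) as [->|e]; [lra|].
    specialize (IH ltac:(lia)). specialize (h j ltac:(lia)). lra. }
unfold I01. rewrite <- h0 at 1. rewrite <- h1. split; apply hle; lia.
Qed.

Lemma variation_sum_ext (lambda : R) (f g : R -> R) (N : nat) (x : nat -> R) :
  (forall t, I01 t -> f t = g t) -> is_partition01 N x ->
  variation_sum lambda f N x = variation_sum lambda g N x.
Proof.
intros hfg hp. apply sum_n_m_ext_loc. intros n hn.
rewrite !hfg by (apply (partition01_I01 N); [exact hp | lia]). reflexivity.
Qed.

Lemma variation_bound_variation (lambda V : R) (f g : R -> R) :
  (forall t, I01 t -> g t = f t) -> variation lambda f = Finite V ->
  variation_bound lambda g V.
Proof.
intros hfg hV N x hp.
destruct (Lub_Rbar_correct (fun t => exists (N : nat) (x : nat -> R),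
  is_partition01 N x /\ t = variation_sum lambda f N x)) as [hub _].
fold (variation lambda f) in hub. rewrite hV in hub.
apply (hub (variation_sum lambda g N x)). exists N, x. split; [exact hp|].
apply variation_sum_ext; assumption.
Qed.

Lemma variation_neq_m_infty (lambda : R) (f : R -> R) :
  variation lambda f <> m_infty.
Proof.
intros e.
destruct (Lub_Rbar_correct (fun t => exists (N : nat) (x : nat -> R),
  is_partition01 N x /\ t = variation_sum lambda f N x)) as [hub _].
fold (variation lambda f) in hub. rewrite e in hub.
apply (hub (variation_sum lambda f 1 INR)). exists 1%nat, INR.
split; [|reflexivity].
repeat split. intros n hn. apply lt_INR. lia.
Qed.

(** * From integers to digit lists, and comparison of the constants *)

Definition digit_list (b k : nat) : list (nat * nat) :=
  map (fun a => (a, digit b k a)) (positions b k).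

Lemma map_fst_digit_list (b k : nat) : map fst (digit_list b k) = positions b k.
Proof. unfold digit_list. rewrite map_map. apply map_id. Qed.

Lemma length_digit_list (b k : nat) : length (digit_list b k) = num_digits b k.
Proof. apply length_map. Qed.

Lemma expansion_digit_list (b k : nat) : (2 <= b)%nat -> expansion b (digit_list b k).
Proof.
(* The range of positions scanned is separated from the integer whose digits are read, so that the
   induction can run on the range alone. *)
intros hb. unfold digit_list, positions. generalize k at 3. intros n.
enough (H : expansion b (map (fun a => (a, digit b k a))
    (filter (fun a => negb (digit b k a =? 0)%nat) (rev (seq 1 n)))) /\
  (lead (map (fun a => (a, digit b k a))
    (filter (fun a => negb (digit b k a =? 0)%nat) (rev (seq 1 n)))) <= n)%nat)
  by apply H.
induction n as [|n [IH1 IH2]]; [split; [exact I | apply Nat.le_refl]|].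
rewrite seq_S, rev_app_distr.
change (rev (1 + n :: nil)%nat) with (S n :: nil). cbn [app filter].
destruct (Nat.eqb_spec (digit b k (S n)) 0) as [e|e]; cbn [negb].
- split; [exact IH1 | lia].
- cbn [map]. split; [|apply Nat.le_refl].
  split; [|split; [|exact IH1]]; cbn [fst snd]; [lia|].
  assert (digit b k (S n) < b)%nat by (apply Nat.mod_upper_bound; lia). lia.
Qed.

Lemma num_digits_pos (b k : nat) : (2 <= b)%nat -> (1 <= k)%nat ->
  (1 <= num_digits b k)%nat.
Proof.
intros hb hk. pose proof (digits_expansion b k hb) as e. unfold num_digits.
destruct (positions b k); [simpl in e | simpl]; lia.
Qed.

Lemma walsh_coef_cwal_coef (b k : nat) (f g : R -> R) :
  (forall x, I01 x -> g x = f x) ->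
  walsh_coef b f k = cwal_coef b (digit_list b k) g.
Proof.
intros h. apply (RInt_ext (V := C_R_CompleteNormedModule)).
rewrite Rmin_left, Rmax_right by lra. intros x hx.
rewrite h by (unfold I01; lra). f_equal.
unfold wal, cwal, digit_list, zeta. rewrite Cpow_conj. f_equal. f_equal.
rewrite map_map. reflexivity.
Qed.

Lemma Rpower_base_ge (b : nat) (lambda : R) : (2 <= b)%nat -> 0 < lambda ->
  INR b - 1 <= Rpower (INR b - 1) (1 + lambda).
Proof.
intros hb hl. assert (h : 2 <= INR b) by (apply (le_INR 2), hb).
rewrite <- (Rpower_1 (INR b - 1)) at 1 by lra.
destruct (Req_dec (INR b - 1) 1) as [->|e].
- unfold Rpower. rewrite ln_1, !Rmult_0_r. lra.
- apply Rle_Rpower; lra.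
Qed.

(** For [b = 2] the middle factor is zero and both sides of the second inequality can be equal; for
    [b >= 3] it follows from [3 (b / 2) <= 2 (b - 1)], with integer division. That inequality is the
    hypothesis on the constant in [cwal_coef_exact_digits]. *)
Lemma half_base_bounds (b : nat) (K : R) : (2 <= b)%nat -> INR b - 1 <= K ->
  INR (b / 2) <= K /\ INR (b / 2) * (2 + middle_factor b) <= 2 * K.
Proof.
intros hb hK.
pose proof (Nat.div_mod_eq b 2) as e. pose proof (Nat.mod_upper_bound b 2) as h.
set (d := (b / 2)%nat) in *.
assert (h1 : INR d <= INR b - 1).
{ assert (h1 : (d + 1 <= b)%nat) by lia. apply le_INR in h1.
  rewrite plus_INR in h1. simpl in h1. lra. }
split; [lra|]. unfold middle_factor.
destruct (Nat.eqb_spec b 2) as [e2|e2]; [lra|].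
assert (h2 : (3 * d + 2 <= 2 * b)%nat) by lia. apply le_INR in h2.
rewrite plus_INR, !mult_INR in h2. simpl in h2. lra.
Qed.

Lemma Rbar_mult_pos_p_infty (x : R) : 0 < x -> Rbar_mult x p_infty = p_infty.
Proof.
intros hx. unfold Rbar_mult, Rbar_mult'.
destruct (Rle_dec 0 x) as [h|h]; [|lra].
destruct (Rle_lt_or_eq_dec 0 x h); [reflexivity | lra].
Qed.

(** * The Walsh coefficient bounds for a finite variation *)

Section Bounds.

Variables (b k : nat) (lambda : R) (f : R -> R).
Hypothesis hb : (2 <= b)%nat.
Hypothesis hlambda : 0 < lambda <= 1.

Lemma walsh_coef_many_digits (r : nat) (V : R) :
  (1 <= r)%nat -> C01 r f -> variation lambda (deriv01_n f r) = Finite V ->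
  (r < num_digits b k)%nat ->
  Cmod (walsh_coef b f k) <=
  Rpower (INR b) (- INR (mu b r k) - lambda * INR (digit_pos b k (r + 1)))
  * (Rpower (INR b - 1) (1 + lambda) * (1 + 2 * Rpower (INR b) (- lambda))
     / (2 * sin (PI / INR b)) ^ r)
  * (1 + 1 / INR b + 1 / (INR b * (INR b + 1))) ^ (r - 1) * V.
Proof.
intros hr hf hV hv.
destruct (C01_extension r f hf) as (G & hG & hGf).
rewrite (walsh_coef_cwal_coef b k f (G 0%nat)) by (intros x; apply hGf; lia).
destruct r as [|r]; [lia|].
assert (hvb := variation_bound_variation lambda V _ (G (S r))
  (fun t => hGf (S r) t (Nat.le_refl _)) hV).
pose proof (variation_bound_nonneg _ _ _ hvb) as hV0.
rewrite <- length_digit_list in hv.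
eapply Rle_trans; [exact (cwal_coef_many_digits b lambda hb hlambda r G V
  _ hG hvb (expansion_digit_list b k hb) hv)|].
rewrite (weight_firstn lambda _ _ hv), map_fst_digit_list.
unfold mu, digit_pos, bpow. replace (S r + 1 - 1)%nat with (S r) by lia.
replace (S r - 1)%nat with r by lia.
rewrite Ropp_plus_distr.
change (INR (list_sum ?l) + - ?x) with (INR (list_sum l) - x).
set (E := Rpower (INR b) (- _ + - _)).
set (E' := Rpower (INR b) (- _ - _)).
change E' with E.
set (P := 1 + 1 / INR b + 1 / (INR b * (INR b + 1))).
assert (hP : 0 < P) by exact (growth_pos b hb).
pose proof (sin_PI_div_pos b hb) as hs.
set (K := Rpower (INR b - 1) (1 + lambda)).
destruct (half_base_bounds b K hb (Rpower_base_ge b lambda hb ltac:(lra))) as [hK _].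
assert (hD : many_digits_constant b lambda <= K * (1 + 2 * Rpower (INR b) (- lambda))).
{ unfold many_digits_constant, bpow.
  pose proof (middle_factor_bounds b).
  assert (hx : 0 < Rpower (INR b) (- lambda)) by apply exp_pos.
  pose proof (pos_INR (b / 2)). apply Rmult_le_compat; nra. }
assert (hE : 0 < E) by apply exp_pos.
set (y := 2 * sin (PI / INR b)) in *.
assert (hy : 0 < y) by (unfold y; lra).
assert (hy' : 0 < / y ^ S r) by (apply Rinv_0_lt_compat, pow_lt, hy).
assert (hPr : 0 < P ^ r) by (apply pow_lt, hP).
replace (/ y * (/ y * P) ^ r * (many_digits_constant b lambda * V) * E) with
  ((E * / y ^ S r * P ^ r * V) * many_digits_constant b lambda)
  by (rewrite Rpow_mult_distr, pow_inv; simpl; field; split;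
      [apply pow_nonzero|]; lra).
replace (E * (K * (1 + 2 * Rpower (INR b) (- lambda)) / y ^ S r) * P ^ r * V)
  with ((E * / y ^ S r * P ^ r * V) * (K * (1 + 2 * Rpower (INR b) (- lambda))))
  by (unfold Rdiv; ring).
apply Rmult_le_compat_l; [|exact hD].
repeat apply Rmult_le_pos; lra.
Qed.

(** The order of differentiation is the number of digits itself, so that the cases [v = r] and
    [v < r] both rest on this bound. *)
Lemma walsh_coef_exact_digits (V : R) (v := num_digits b k) :
  (1 <= v)%nat -> C01 v f -> variation lambda (deriv01_n f v) = Finite V ->
  Cmod (walsh_coef b f k) <=
  Rpower (INR b) (- INR (mu b v k)) / (2 * sin (PI / INR b)) ^ v
  * (1 + 1 / INR b + 1 / (INR b * (INR b + 1))) ^ (v - 1)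
  * (Rabs (RInt (deriv01_n f v) 0 1)
     + 2 * Rpower (INR b - 1) (1 + lambda)
       * Rpower (INR b) (- lambda * INR (digit_pos b k v)) * V).
Proof.
intros hv hf hV.
destruct (C01_extension v f hf) as (G & hG & hGf).
rewrite (walsh_coef_cwal_coef b k f (G 0%nat)) by (intros x; apply hGf; lia).
assert (hvb := variation_bound_variation lambda V _ (G v)
  (fun t => hGf v t (Nat.le_refl _)) hV).
assert (hl : length (digit_list b k) = v) by apply length_digit_list.
assert (hmu : mu b v k = list_sum (positions b k)).
{ unfold mu. rewrite firstn_all2; [reflexivity | apply Nat.le_refl]. }
rewrite hmu.
assert (hint : RInt (deriv01_n f v) 0 1 = RInt (G v) 0 1).
{ apply RInt_ext. rewrite Rmin_left, Rmax_right by lra. intros x hx.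
  symmetry. apply hGf; [lia | unfold I01; lra]. }
rewrite hint. clearbody v. destruct v as [|r]; [lia|].
set (K := Rpower (INR b - 1) (1 + lambda)).
destruct (half_base_bounds b K hb (Rpower_base_ge b lambda hb ltac:(lra))) as [_ hK].
eapply Rle_trans; [exact (cwal_coef_exact_digits b lambda hb hlambda r G V K
  _ hK hG hvb (expansion_digit_list b k hb) hl)|].
rewrite map_fst_digit_list. unfold digit_pos, bpow.
replace (S r - 1)%nat with r by lia.
rewrite <- Ropp_mult_distr_l.
pose proof (sin_PI_div_pos b hb) as hs.
right. rewrite Rpow_mult_distr, pow_inv. simpl. field.
pose proof (le_INR 2 b hb). simpl in *.
repeat split; try lra; try nra; apply pow_nonzero; lra.
Qed.

End Bounds.

Theorem theorem2 (b r k v : nat) (lambda : R) (f : R -> R)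
  (hb : (2 <= b)%nat) (hr : (1 <= r)%nat) (hlambda : 0 < lambda <= 1)
  (hf : C01 r f)
  (hV : Rbar_lt (variation lambda (deriv01_n f r)) p_infty)
  (hk : (1 <= k)%nat) (hv : num_digits b k = v) :
  ((r < v)%nat ->
    Rbar_le (Cmod (walsh_coef b f k))
      (Rbar_mult
        (Rpower (INR b) (- INR (mu b r k) - lambda * INR (digit_pos b k (r + 1)))
         * (Rpower (INR b - 1) (1 + lambda) * (1 + 2 * Rpower (INR b) (- lambda))
            / (2 * sin (PI / INR b)) ^ r)
         * (1 + 1 / INR b + 1 / (INR b * (INR b + 1))) ^ (r - 1))
        (variation lambda (deriv01_n f r))))
  /\
  (v = r ->
    Rbar_le (Cmod (walsh_coef b f k))
      (Rbar_mult
        (Rpower (INR b) (- INR (mu b r k)) / (2 * sin (PI / INR b)) ^ r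
         * (1 + 1 / INR b + 1 / (INR b * (INR b + 1))) ^ (r - 1))
        (Rbar_plus
          (Rabs (RInt (deriv01_n f r) 0 1))
          (Rbar_mult
            (2 * Rpower (INR b - 1) (1 + lambda)
             * Rpower (INR b) (- lambda * INR (digit_pos b k r)))
            (variation lambda (deriv01_n f r))))))
  /\
  ((v < r)%nat ->
    Rbar_le (Cmod (walsh_coef b f k))
      (Rbar_mult
        (Rpower (INR b) (- INR (mu b r k)) / (2 * sin (PI / INR b)) ^ v
         * (1 + 1 / INR b + 1 / (INR b * (INR b + 1))) ^ (v - 1))
        (Rbar_plus
          (3 * sum_n_m (fun s => Rabs (deriv01_n f s 0) / INR (fact (s - v + 1)))
                 v (r - 1))
          (Rbar_plus
            (Rabs (RInt (deriv01_n f v) 0 1))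
            (Rbar_mult
              (2 * Rpower (INR b - 1) (1 + lambda)
               * Rpower (INR b) (- lambda * INR (digit_pos b k v)))
              (variation lambda (deriv01_n f v))))))).
Proof.
pose proof (num_digits_pos b k hb hk) as hv1.
destruct (variation lambda (deriv01_n f r)) as [V| |] eqn:hVr;
  [|contradiction|elim (variation_neq_m_infty _ _ hVr)].
split; [|split].
- intros h. rewrite <- hv in h.
  exact (walsh_coef_many_digits b k lambda f hb hlambda r V hr hf hVr h).
- intros e. rewrite e in hv. clear e. subst r.
  exact (walsh_coef_exact_digits b k lambda f hb hlambda V hv1 hf hVr).
- intros h. subst v. set (v := num_digits b k) in *.
  (* Both orders take in all the positions, there being only [v] of them. *)
  assert (hmu : mu b r k = mu b v k).
  { unfold mu. rewrite !firstn_all2; [reflexivity | apply Nat.le_refl |].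
    apply Nat.lt_le_incl, h. }
  rewrite hmu.
  set (c := Rpower (INR b) (- INR (mu b v k)) / (2 * sin (PI / INR b)) ^ v
         * (1 + 1 / INR b + 1 / (INR b * (INR b + 1))) ^ (v - 1)).
  assert (hc : 0 < c).
  { apply Rmult_lt_0_compat; [apply Rdiv_lt_0_compat; [apply exp_pos|]|].
    - pose proof (sin_PI_div_pos b hb). apply pow_lt. lra.
    - apply pow_lt. exact (growth_pos b hb). }
  (* For a finite variation the bound at order [v] applies, and the sum of the derivatives at 0 is
     nonnegative. For an infinite one the right-hand side is [p_infty], its factors being
     positive. *)
  destruct (variation lambda (deriv01_n f v)) as [W| |] eqn:hVv.
  + pose proof (walsh_coef_exact_digits b k lambda f hb hlambda W hv1
      (C01_le v r f ltac:(lia) hf) hVv) as H. fold v in H. fold c in H.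
    assert (hs : 0 <= sum_n_m (fun s => Rabs (deriv01_n f s 0) /
      INR (fact (s - v + 1))) v (r - 1)).
    { apply sum_n_m_nonneg. intros s. apply Rdiv_le_0_compat; [apply Rabs_pos|].
      apply INR_fact_lt_0. }
    eapply Rle_trans; [exact H|].
    apply Rmult_le_compat_l; [lra|]. simpl. lra.
  + rewrite (Rbar_mult_pos_p_infty (2 * _ * _)).
    * change (Rbar_le (Cmod (walsh_coef b f k)) (Rbar_mult c p_infty)).
      rewrite Rbar_mult_pos_p_infty by exact hc. exact I.
    * apply Rmult_lt_0_compat; [|apply exp_pos].
      apply Rmult_lt_0_compat; [lra | apply exp_pos].
  + elim (variation_neq_m_infty _ _ hVv).
Qed.
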